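(* The set $\widetilde{\mathfrak{C}}=\{(C,D)\in\mathbb{CP}^5\times\mathfrak{U} : -\sigma_{1,2}^2+4\sigma_{0,3}\sigma_{2,1}=0\}$ is the total space of a smooth trivial fiber bundle over $\mathfrak{U}$, with bundle projection $(C,D)\mapsto D$, and with a connected general fiber.
   Context: A conic in $\mathbb{CP}^2$ is identified with its symmetric $3\times 3$ complex matrix up to a non-zero scalar, so conics (possibly degenerate) form $\mathbb{CP}^5$. $\mathfrak{U}\subset\mathbb{CP}^5$ is the open set of non-degenerate conics ($\det\neq 0$). For matrices $C,D$ write $\det(tC+D)=\sigma_{3,0}t^3+\sigma_{2,1}t^2+\sigma_{1,2}t+\sigma_{0,3}$; the $\sigma_{i,j}$ are bihomogeneous polynomials in the entries of $C$ and $D$, and the equation $-\sigma_{1,2}^2+4\sigma_{0,3}\sigma_{2,1}=0$ is bihomogeneous of bidegree $(2,4)$ in $(C,D)$.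
   Formalization: ''Trivial fiber bundle'' is proved as ''locally trivial fiber bundle'' with one connected model fiber: a global product decomposition is false, since the bundle restricted to a suitable 2-sphere in the base is a topologically nontrivial bundle of quadrics. *)

(* Defs.v *)
(* The complex numbers are R[i], over an arbitrary model R of the real numbers. *)
From HB Require Import structures.
From mathcomp Require Import all_boot all_order all_algebra.
From mathcomp Require Import all_classical all_reals all_analysis.
From mathcomp Require Import generic_quotient complex.

Set Implicit Arguments.
Unset Strict Implicit.
Unset Printing Implicit Defensive.
Import Order.TTheory GRing.Theory Num.Theory.
Import numFieldNormedType.Exports.
Local Open Scope classical_set_scope.
Local Open Scope ring_scope.
Local Open Scope complex_scope.

(** * C^oo maps, charts, embedded submanifolds and smooth fiber bundles *)

(* To be used with U open and V finite-dimensional: then f is C^(k+1) on U iff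
   it is differentiable on U and all its directional derivatives are C^k. *)
Fixpoint Ck (R : realType) (V W : normedModType R) (k : nat)
    (U : set V) (f : V -> W) : Prop :=
  match k with
  | 0%N => forall x, U x -> {for x, continuous f}
  | k'.+1 => (forall x, U x -> differentiable f x) /\
             (forall v, Ck k' U (fun x => 'd f x v))
  end.

Definition Coo (R : realType) (V W : normedModType R)
    (U : set V) (f : V -> W) : Prop := forall k, Ck k U f.

(* The values of chart_map outside chart_dom are irrelevant. *)
Record chart (R : realType) (T : Type) (n : nat) := Chart {
  chart_dom : set T ;
  chart_map : T -> 'rV[R]_n }.

(* A topological space with a distinguished set of R^n-valued charts. *)
Record charted (R : realType) := Charted {
  space :> topologicalType ;
  mdim : nat ;
  atlas : set (chart R space mdim) }.

Definition prod_chart (R : realType) (S T : Type) (m n : nat)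
    (a : chart R S m) (b : chart R T n) : chart R (S * T) (m + n) :=
  Chart (chart_dom a `*` chart_dom b)
        (fun z => row_mx (chart_map a z.1) (chart_map b z.2)).

Definition prod_charted (R : realType) (M N : charted R) : charted R :=
  @Charted R (space M * space N)%type (mdim M + mdim N)
    [set c | exists a b, [/\ atlas a, atlas b & c = prod_chart a b]].

(* Smoothness of a map on an arbitrary subset A of a manifold: near each point
   of A the map is, in charts, the restriction to A of a C^oo map defined on an
   open set of the model space. *)
Definition smooth_map_on (R : realType) (M N : charted R)
    (A : set M) (f : M -> N) : Prop :=
  forall x, A x ->
  exists (c : chart R M (mdim M)) (d : chart R N (mdim N))
         (O : set 'rV[R]_(mdim M)) (g : 'rV[R]_(mdim M) -> 'rV[R]_(mdim N)),
    [/\ atlas c /\ atlas d,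
        chart_dom c x /\ chart_dom d (f x),
        open O /\ O (chart_map c x),
        Coo O g &
        forall y, A y -> chart_dom c y -> O (chart_map c y) ->
          chart_dom d (f y) /\ chart_map d (f y) = g (chart_map c y)].

Definition diffeo_on (R : realType) (M N : charted R)
    (A : set M) (B : set N) (f : M -> N) (g : N -> M) : Prop :=
  [/\ smooth_map_on A f,
      smooth_map_on B g,
      forall x, A x -> B (f x) /\ g (f x) = x &
      forall y, B y -> A (g y) /\ f (g y) = y].

(* Slice charts: in suitable smooth coordinates phi (with inverse psi) around
   each of its points, S is given by the vanishing of all the coordinates of
   index at least k. *)
Definition embedded_submanifold (R : realType) (M : charted R) (k : nat)
    (S : set M) : Prop :=
  (k <= mdim M)%N /\
  forall x, S x ->
  exists (c : chart R M (mdim M)) (O O' : set 'rV[R]_(mdim M))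
         (phi psi : 'rV[R]_(mdim M) -> 'rV[R]_(mdim M)),
    [/\ atlas c /\ chart_dom c x,
        [/\ open O, O (chart_map c x) & O `<=` chart_map c @` chart_dom c],
        [/\ open O', Coo O phi & Coo O' psi],
        (forall u, O u -> O' (phi u) /\ psi (phi u) = u) /\
        (forall v, O' v -> O (psi v) /\ phi (psi v) = v) &
        forall y, chart_dom c y -> O (chart_map c y) ->
          (S y <-> forall j : 'I_(mdim M), (k <= j)%N ->
                     phi (chart_map c y) ord0 j = 0)].

Definition smooth_trivialization (R : realType) (X Y Z : charted R)
    (E : set X) (F : set Z) (p : X -> Y) (W : set Y) : Prop :=
  exists (Phi : X -> Y * Z) (Psi : Y * Z -> X),
    diffeo_on (N := prod_charted Y Z) (E `&` p @^-1` W) (W `*` F) Phi Psi /\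
    (forall e, E e -> W (p e) -> (Phi e).1 = p e).

(* Smooth locally trivial bundle with total space E, base B, fiber F and
   projection p; E, B and F are submanifolds of ambient manifolds. *)
Definition smooth_fiber_bundle (R : realType) (X Y Z : charted R)
    (E : set X) (B : set Y) (F : set Z) (p : X -> Y) : Prop :=
  [/\ [/\ exists k, embedded_submanifold k E,
          exists k, embedded_submanifold k B &
          exists k, embedded_submanifold k F],
      smooth_map_on E p,
      p @` E = B &
      forall b, B b -> exists W : set Y,
        [/\ open W, W b & smooth_trivialization E F p (W `&` B)]].

(** * The projective space of conics *)

(* The topology of R[i] given by the complex modulus. *)
HB.instance Definition _ (R : realType) := NormedModule.copy R[i] R[i]^o.

Definition nzsym (R : realType) : set 'M[R[i]]_3 :=
  [set A | A^T = A /\ A != 0].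

Arguments nzsym R : clear implicits.

Section ConicSpace.
Context {R : realType}.

Definition proportional (A B : nzsym R) : bool :=
  `[< exists2 k : R[i], k != 0 & set_val B = k *: set_val A >].

Lemma proportional_refl : reflexive proportional.
Proof. by move=> A; apply/asboolP; exists 1; rewrite ?oner_neq0 ?scale1r. Qed.

Lemma proportional_sym : symmetric proportional.
Proof.
suff H A B : proportional A B -> proportional B A.
  by move=> A B; apply/idP/idP; apply: H.
move=> /asboolP[k k0 eB]; apply/asboolP; exists k^-1; rewrite ?invr_eq0 //.
by rewrite eB scalerA mulVf // scale1r.
Qed.

Lemma proportional_trans : transitive proportional.
Proof.
move=> B A D /asboolP[k k0 eB] /asboolP[l l0 eD]; apply/asboolP.
by exists (l * k); rewrite ?mulf_neq0 // eD eB scalerA.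
Qed.

Canonical proportional_equiv :=
  EquivRel proportional proportional_refl proportional_sym proportional_trans.

Definition conic := quotient_topology {eq_quot proportional}%qT.

(* A representative matrix; what follows does not depend on its choice, all the
   conditions imposed on it being homogeneous. *)
Definition conic_mx (p : conic) : 'M[R[i]]_3 := set_val (repr p).

(* The homogeneous coordinates on CP^5: the entries of indices (0,0), (0,1),
   (0,2), (1,1), (1,2), (2,2). *)
Definition conic_coord (p : conic) (a : 'I_6) : R[i] :=
  let ij := nth (0, 0)%N [:: (0, 0); (0, 1); (0, 2); (1, 1); (1, 2); (2, 2)]%N a
  in conic_mx p (inord ij.1) (inord ij.2).

(* The standard affine chart: the real and imaginary parts of the five
   quotients x_b / x_a, b <> a, on the open set x_a <> 0. *)
Definition affine_chart (a : 'I_6) : chart R conic (5 + 5) :=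
  let z p (b : 'I_5) := conic_coord p (lift a b) / conic_coord p a in
  Chart [set p | conic_coord p a != 0]
        (fun p => row_mx (\row_b complex.Re (z p b)) (\row_b complex.Im (z p b))).

End ConicSpace.

Arguments conic R : clear implicits.

Definition CP5 (R : realType) : charted R :=
  @Charted R (conic R) (5 + 5) (range affine_chart).

Definition nondeg_conics (R : realType) : set (CP5 R) :=
  [set D | \det (conic_mx D) != 0].

Arguments nondeg_conics R : clear implicits.

(* The coefficient sigma_(i, 3 - i) of t^i in det (t C + D). *)
Definition sigma (R : realType) (C D : 'M[R[i]]_3) (i : nat) : R[i] :=
  (\det ('X *: map_mx polyC C + map_mx polyC D))`_i.

Definition tildeC (R : realType) : set (prod_charted (CP5 R) (CP5 R)) :=
  [set CD | nondeg_conics R CD.2 /\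
     let s := sigma (conic_mx CD.1) (conic_mx CD.2) in
     - s 1%N ^+ 2 + 4%:R * s 0%N * s 2%N = 0].

Arguments tildeC R : clear implicits.

(* Main.v *)
Require Import Defs.
From HB Require Import structures.
From mathcomp Require Import all_boot all_order all_algebra fingroup perm.
From mathcomp Require Import all_classical all_reals all_analysis.
From mathcomp Require Import generic_quotient complex.
From mathcomp Require Import ring lra.

(* The fiber of [tildeC] over D is a quadric [q_D = 0] in the space of symmetric
   matrices A, and q is equivariant: q_(P D P^T) (P A P^T) = (det P)^4 q_D (A).
   Near a given nondegenerate conic, D = G G^T with G depending smoothly on D:
   a constant congruence to the identity is followed by a Cholesky factorization,
   which only takes square roots of numbers with positive real part. Hence
   A |-> G^-1 A G^-T identifies the nearby fibers with the quadric q_1 = 0.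
   The polar form of q_D is nondegenerate, so at each point of q_D = 0 some affine
   coordinate z of A satisfies dq_D / dz <> 0; as q_D is quadratic in z, solving
   for z by radicals gives an explicit slice chart, without the implicit function
   theorem. The quadric q_1 = 0 is connected because any two of its points are
   orthogonal to a common third one, hence joined to it by lines of the quadric. *)

Set Implicit Arguments.
Unset Strict Implicit.
Unset Printing Implicit Defensive.
Import Order.TTheory GRing.Theory Num.Theory.
Import numFieldNormedType.Exports.
Local Open Scope classical_set_scope.
Local Open Scope ring_scope.
Local Open Scope complex_scope.

(** * Smooth maps given by explicit formulas *)

(** [Coo] quantifies over all iterated directional derivatives, so smoothness is certified
    syntactically: the maps are written as explicit formulas in coordinates, sums, products,
    inverses and square roots of positive functions, a class stable under differentiation. This is
    what calls for radicals in place of existence theorems, both for G and for the slice charts.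
    With B = D^-1 A, the coefficients sigma are det D times the elementary symmetric functions of
    the eigenvalues of B, so q_D (A) = (det D)^2 (4 e_2(B) - e_1(B)^2); in particular q_1 (A) = (tr
    A)^2 - 2 tr(A^2). A second obstacle is that [conic_mx] is an arbitrary representative, with no
    continuity guaranteed. Local formulas therefore use the representative [aff_mx], normalized by
    one entry equal to 1, and homogeneity of q carries the results back. Finally, G is determined by
    D only up to a right factor in O(3), and a smooth choice of it is made near each point of the
    base separately. *)

Lemma diff_coord (R : realType) N (j : 'I_N) (x : 'rV[R]_N) :
  differentiable (fun y : 'rV[R]_N => y 0 j) x /\
  'd (fun y : 'rV[R]_N => y 0 j) x = (fun y => y 0 j) :> ('rV[R]_N -> R).
Proof.
split; first exact: differentiable_coord.
have lin : linear (fun y : 'rV[R]_N => y 0 j : R^o).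
  by move=> a u w; rewrite !mxE.
pose c : {linear 'rV[R]_N -> R} :=
  HB.pack (fun y : 'rV[R]_N => y 0 j) (GRing.isLinear.Build _ _ _ _ _ lin).
by apply: (@diff_lin _ _ _ c); exact: coord_continuous.
Qed.

Section Smooth.
Context {R : realType} {N : nat}.
Implicit Types U O : set 'rV[R]_N.

(* Closed under directional derivatives (lemma [smR_deriv]), hence C^oo. *)
Inductive smR U : ('rV[R]_N -> R) -> Prop :=
| smR_cst c : smR U (fun=> c)
| smR_coord j : smR U (fun x => x 0 j)
| smR_add f g : smR U f -> smR U g -> smR U (fun x => f x + g x)
| smR_mul f g : smR U f -> smR U g -> smR U (fun x => f x * g x)
| smR_inv f : smR U f -> (forall x, U x -> f x != 0) ->
    smR U (fun x => (f x)^-1)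
| smR_sqrt f : smR U f -> (forall x, U x -> 0 < f x) ->
    smR U (fun x => Num.sqrt (f x))
| smR_ext f g : smR U f -> (forall x, U x -> f x = g x) -> smR U g.

(** The differential depends only on the germ. [smR_ext] identifies functions on U only, whereas
    ['d f x] refers to the whole function. *)
Lemma near_eq_differentiable (W : normedModType R) (f g : 'rV[R]_N -> W) x :
  (\forall y \near x, f y = g y) -> differentiable f x ->
  differentiable g x /\ 'd g x = 'd f x :> (_ -> _).
Proof.
move=> fg df.
have fgx : f x = g x by exact: nbhs_singleton fg.
have cd : continuous ('d f x) by exact: diff_continuous.
have H : g \o shift x = cst (g x) + 'd f x +o_ 0 id.
  have /eqaddoP Hf := diff_locally df.
  apply/eqaddoP => e e0; have := Hf e e0.
  have fg0 : \forall y \near (0 : 'rV[R]_N), f (y + x) = g (y + x).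
    by move/(nbhs0P (fun y => f y = g y)): fg; apply: filterS => y; rewrite [x + y]addrC.
  move=> H1; near=> y.
  have E : f (y + x) = g (y + x) by near: y.
  have : `|(f \o shift x - (cst (f x) + 'd f x)) y| <= e * `|y| by near: y.
  by rewrite !fctE /= E fgx.
have D := @diff_unique _ _ _ g _ x cd H.
by split; [apply/diff_locallyP; rewrite D; split | exact: D].
Unshelve. all: by end_near. Qed.

Lemma smR_differentiable U f x : open U -> smR U f -> U x -> differentiable f x.
Proof.
move=> oU sf Ux; elim: sf => {f}.
- by move=> c; exact: differentiable_cst.
- by move=> j; exact: differentiable_coord.
- by move=> f g _ df _ dg; exact: (differentiableD df dg).
- by move=> f g _ df _ dg; exact: (differentiableM df dg).
- by move=> f _ df f0; exact: differentiableV (f0 x Ux).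
- move=> f _ df f0; apply: (@differentiable_comp _ _ _ _ f Num.sqrt) => //.
  by apply/derivable1_diffP; case: (is_derive1_sqrt (f0 x Ux)).
- move=> f g _ df fg; apply: (proj1 (near_eq_differentiable _ df)).
  have := open_nbhs_nbhs (conj oU Ux); apply: filterS => y; exact: fg.
Qed.

Lemma smR_opp U f : smR U f -> smR U (fun x => - f x).
Proof.
move=> sf; apply: (@smR_ext _ (fun x => (-1) * f x)).
  by apply: smR_mul => //; exact: smR_cst.
by move=> x _; rewrite mulN1r.
Qed.

(** Each differentiation rule stays in the class: 1/f contributes -f'/f^2 and sqrt f contributes
    f'/(2 sqrt f), with denominators that do not vanish on U by the side conditions of the
    constructors. *)
Lemma smR_deriv U f v : open U -> smR U f -> smR U (fun x => 'd f x v).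
Proof.
move=> oU; elim=> {f}.
- move=> c; apply: (@smR_ext _ (fun=> 0)); first exact: smR_cst.
  by move=> x _; rewrite diff_cst.
- move=> j; apply: (@smR_ext _ (fun=> v 0 j)); first exact: smR_cst.
  move=> x _.
  by rewrite (proj2 (diff_coord j x)).
- move=> f g sf df sg dg; apply: smR_ext (smR_add df dg) _ => x Ux.
  have [d1 d2] := (smR_differentiable oU sf Ux, smR_differentiable oU sg Ux).
  exact: esym (congr1 (@^~ v) (diffD d1 d2)).
- move=> f g sf df sg dg.
  apply: smR_ext (smR_add (smR_mul sf dg) (smR_mul sg df)) _ => x Ux.
  have [d1 d2] := (smR_differentiable oU sf Ux, smR_differentiable oU sg Ux).
  exact: esym (congr1 (@^~ v) (diffM d1 d2)).
- move=> f sf df f0.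
  apply: smR_ext (smR_mul (smR_opp (smR_inv (smR_mul sf sf) _)) df) _.
    by move=> x Ux; rewrite mulf_neq0 ?f0.
  move=> x Ux; have df' := smR_differentiable oU sf Ux.
  exact: esym (congr1 (@^~ v) (diffV df' (f0 x Ux))).
- move=> f sf df f0.
  have s2 : smR U (fun x => (2 * Num.sqrt (f x))^-1).
    apply: smR_inv; last first.
      by move=> x Ux; rewrite gt_eqF // mulr_gt0 // sqrtr_gt0 f0.
    by apply: smR_mul; [exact: smR_cst | exact: smR_sqrt].
  apply: smR_ext (smR_mul df s2) _ => x Ux.
  have [ds <-] := is_derive1_sqrt (f0 x Ux).
  have ds' : differentiable (Num.sqrt : R -> R) (f x) by exact/derivable1_diffP.
  have df' := smR_differentiable oU sf Ux.
  apply: (etrans _ (esym (congr1 (@^~ v) (diff_comp df' ds')))).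
  apply: (etrans _ (esym (congr1 (@^~ ('d f x v)) (diff1E ds')))).
  by rewrite derive1E.
- move=> f g sf df fg; apply: smR_ext df _ => x Ux.
  have df' := smR_differentiable oU sf Ux.
  have nfg : \forall y \near x, f y = g y.
    by have := open_nbhs_nbhs (conj oU Ux); apply: filterS => y; exact: fg.
  exact: esym (congr1 (@^~ v) (near_eq_differentiable nfg df').2).
Qed.

Lemma smR_continuous U f x : open U -> smR U f -> U x -> {for x, continuous f}.
Proof.
move=> oU sf Ux; apply: differentiable_continuous.
exact: smR_differentiable oU sf Ux.
Qed.

Lemma smR_sub U O f : U `<=` O -> smR O f -> smR U f.
Proof.
move=> UO; elim=> {f}; [exact: smR_cst|exact: smR_coord|by move=> *; exact: smR_add|
  by move=> *; exact: smR_mul|..].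
- by move=> f _ sf f0; apply: smR_inv => // x /UO; exact: f0.
- by move=> f _ sf f0; apply: smR_sqrt => // x /UO; exact: f0.
- by move=> f g _ sf fg; apply: smR_ext sf _ => // x /UO; exact: fg.
Qed.

Definition smV M U (f : 'rV[R]_N -> 'rV[R]_M) := forall j, smR U (fun x => f x 0 j).

Lemma smV_differentiable M U (f : 'rV[R]_N -> 'rV[R]_M) x :
  open U -> smV U f -> U x ->
  differentiable f x /\ forall v j, 'd f x v 0 j = 'd (fun y => f y 0 j) x v.
Proof.
move=> oU sf Ux.
pose fj j : 'rV[R]_N -> 'rV[R]_M := fun y => f y 0 j *: delta_mx 0 j.
have fE : f = \sum_j fj j.
  apply/funext=> y; rewrite fct_sumE; rewrite [LHS]row_sum_delta.
  by apply: eq_bigr.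
have df : differentiable f x.
  rewrite fE; apply: differentiable_sum => j; apply: differentiableZl.
  exact: smR_differentiable (sf j) Ux.
split=> // v j.
have [dc cE] := diff_coord j (f x).
apply: (etrans _ (esym (congr1 (@^~ v) (diff_comp df dc)))).
exact: esym (congr1 (@^~ ('d f x v)) cE).
Qed.

(** Induction on the order, with f generalized: the derivative of f in a fixed direction again has
    [smR] components. *)
Lemma smV_Coo M U (f : 'rV[R]_N -> 'rV[R]_M) : open U -> smV U f -> Coo U f.
Proof.
move=> oU sf k; elim: k f sf => [|k IH] f sf /=.
  move=> x Ux; apply: differentiable_continuous.
  exact: (proj1 (smV_differentiable oU sf Ux)).
split=> [x Ux|v]; first exact: (proj1 (smV_differentiable oU sf Ux)).
apply: IH => j; apply: smR_ext (smR_deriv v oU (sf j)) _ => x Ux.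
exact: esym ((smV_differentiable oU sf Ux).2 v j).
Qed.

End Smooth.

Lemma smR_comp (R : realType) N M (U : set 'rV[R]_N) (O : set 'rV[R]_M)
    (f : 'rV[R]_M -> R) (g : 'rV[R]_N -> 'rV[R]_M) :
  smV U g -> (forall x, U x -> O (g x)) -> smR O f -> smR U (f \o g).
Proof.
move=> sg UO; elim=> {f}; [move=> c; exact: smR_cst|move=> j; exact: sg|..].
- by move=> f1 f2 _ s1 _ s2; exact: (smR_add s1 s2).
- by move=> f1 f2 _ s1 _ s2; exact: (smR_mul s1 s2).
- by move=> f _ sf f0; apply: (smR_inv sf) => x /UO; exact: f0.
- by move=> f _ sf f0; apply: (smR_sqrt sf) => x /UO; exact: f0.
- by move=> f1 f2 _ sf f12; apply: (smR_ext sf) => x /UO; exact: f12.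
Qed.

Lemma open_smR_gt0 (R : realType) N (U : set 'rV[R]_N) (f : 'rV[R]_N -> R) :
  open U -> smR U f -> open (U `&` [set x | 0 < f x]).
Proof.
move=> oU sf; rewrite openE => x [Ux fx]; rewrite /interior.
apply: filterI; first exact: open_nbhs_nbhs (conj oU Ux).
exact: (@cvgr_gt _ _ _ _ _ _ (smR_continuous oU sf Ux)).
Qed.

(** * Smooth functions with complex and matrix values *)

Section ComplexSmooth.
Context {R : realType}.
Local Notation C := (R[i]).
Local Notation cRe := (@complex.Re R).
Local Notation cIm := (@complex.Im R).

Lemma cReM (x y : C) : cRe (x * y) = cRe x * cRe y - cIm x * cIm y.
Proof. by case: x; case: y. Qed.

Lemma cImM (x y : C) : cIm (x * y) = cRe x * cIm y + cIm x * cRe y.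
Proof. by case: x; case: y. Qed.

Lemma cReD (x y : C) : cRe (x + y) = cRe x + cRe y.
Proof. by case: x; case: y. Qed.

Lemma cImD (x y : C) : cIm (x + y) = cIm x + cIm y.
Proof. by case: x; case: y. Qed.

Lemma cReV (x : C) : cRe (x^-1) = cRe x / (cRe x ^+ 2 + cIm x ^+ 2).
Proof. by case: x. Qed.

Lemma cImV (x : C) : cIm (x^-1) = - (cIm x / (cRe x ^+ 2 + cIm x ^+ 2)).
Proof. by case: x. Qed.

Lemma complexP (x y : C) : cRe x = cRe y -> cIm x = cIm y -> x = y.
Proof. by case: x => a b; case: y => c d /= -> ->. Qed.

Lemma sqnorm_gt0 (x : C) : (0 < cRe x ^+ 2 + cIm x ^+ 2) = (x != 0).
Proof.
rewrite lt0r addr_ge0 ?sqr_ge0 // andbT paddr_eq0 ?sqr_ge0 // !sqrf_eq0.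
by case: x => a b; rewrite eq_complex.
Qed.

Lemma cRe_gt0_neq0 (x : C) : 0 < cRe x -> x != 0.
Proof. by move=> x0; apply: contraTneq x0 => ->; rewrite ltxx. Qed.

(* The principal square root, in a form that is smooth on [0 < Re z]. *)
Definition csqrt (z : C) : C :=
  let s := Num.sqrt ((Num.sqrt (cRe z ^+ 2 + cIm z ^+ 2) + cRe z) / 2) in
  s +i* (cIm z / (2 * s)).

Lemma csqrt_Re_gt0 (z : C) : 0 < cRe z -> 0 < cRe (csqrt z).
Proof.
by move=> z0; rewrite sqrtr_gt0 divr_gt0 // ltr_wpDl // sqrtr_ge0.
Qed.

Lemma csqrtK (z : C) : 0 < cRe z -> csqrt z ^+ 2 = z.
Proof.
move=> z0; have := csqrt_Re_gt0 z0; rewrite expr2 /=.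
set s := Num.sqrt (_ / 2) => s0.
set r := Num.sqrt (_ + _) in s s0 *.
have r2 : r ^+ 2 = cRe z ^+ 2 + cIm z ^+ 2 by rewrite sqr_sqrtr // addr_ge0 ?sqr_ge0.
have s2 : s ^+ 2 = (r + cRe z) / 2.
  by rewrite sqr_sqrtr // divr_ge0 // addr_ge0 ?sqrtr_ge0 // ltW.
have sn : s != 0 by rewrite gt_eqF.
have b2 : cIm z ^+ 2 = (r - cRe z) * (2 * s ^+ 2) by rewrite s2; lra.
apply: complexP; rewrite ?cReM ?cImM /=; last by field.
have -> : s * s - cIm z / (2 * s) * (cIm z / (2 * s)) =
    s ^+ 2 - cIm z ^+ 2 / (4 * s ^+ 2) by field.
have -> : s ^+ 2 - cIm z ^+ 2 / (4 * s ^+ 2) = s ^+ 2 - (r - cRe z) / 2.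
  by rewrite b2; field.
by rewrite s2; lra.
Qed.

(** Of the two roots w and -w only one lies in the right half-plane. This identifies a branch
    without a continuity argument. *)
Lemma csqrt_unique (z w : C) : 0 < cRe z -> 0 < cRe w -> w ^+ 2 = z -> csqrt z = w.
Proof.
move=> z0 w0 wz; have := csqrtK z0; rewrite -wz => /eqP.
rewrite eqf_sqr => /orP[/eqP //|/eqP E].
have := csqrt_Re_gt0 z0; rewrite -wz E => {E wz}.
by case: w w0 => a b /= a0; rewrite oppr_gt0 => /(lt_trans a0); rewrite ltxx.
Qed.

Context {N : nat}.
Implicit Types (U : set 'rV[R]_N) (f g : 'rV[R]_N -> C).

Definition smC U f := smR U (cRe \o f) /\ smR U (cIm \o f).

Lemma smC_ext U f g : smC U f -> (forall x, U x -> f x = g x) -> smC U g.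
Proof. by move=> [s1 s2] fg; split; apply: smR_ext;
  [exact: s1| |exact: s2|] => x Ux /=; rewrite fg. Qed.

Lemma smC_sub U O f : U `<=` O -> smC O f -> smC U f.
Proof. by move=> UO [s1 s2]; split; exact: smR_sub UO _. Qed.

Lemma smC_cst U c : smC U (fun=> c).
Proof. by split; exact: smR_cst. Qed.

Lemma smC_coord U i j : smC U (fun x => x 0 i +i* x 0 j).
Proof. by split; exact: smR_coord. Qed.

Lemma smC_add U f g : smC U f -> smC U g -> smC U (fun x => f x + g x).
Proof.
move=> [f1 f2] [g1 g2]; split.
  by apply: (smR_ext (smR_add f1 g1)) => x _ /=; rewrite cReD.
by apply: (smR_ext (smR_add f2 g2)) => x _ /=; rewrite cImD.
Qed.

Lemma smC_mul U f g : smC U f -> smC U g -> smC U (fun x => f x * g x).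
Proof.
move=> [f1 f2] [g1 g2]; split.
  by apply: (smR_ext (smR_add (smR_mul f1 g1) (smR_opp (smR_mul f2 g2)))) => x _ /=;
    rewrite cReM.
by apply: (smR_ext (smR_add (smR_mul f1 g2) (smR_mul f2 g1))) => x _ /=; rewrite cImM.
Qed.

Lemma smC_opp U f : smC U f -> smC U (fun x => - f x).
Proof.
move=> sf; apply: smC_ext (smC_mul (smC_cst U (-1)) sf) _ => x _.
by rewrite mulN1r.
Qed.

Lemma smR_sqnorm U f : smC U f -> smR U (fun x => cRe (f x) ^+ 2 + cIm (f x) ^+ 2).
Proof. by move=> [f1 f2]; exact: (smR_add (smR_mul f1 f1) (smR_mul f2 f2)). Qed.

Lemma smC_inv U f : smC U f -> (forall x, U x -> f x != 0) ->
  smC U (fun x => (f x)^-1).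
Proof.
move=> sf f0; have := smR_sqnorm sf; case: sf => f1 f2 f3.
have f4 : smR U (fun x => (cRe (f x) ^+ 2 + cIm (f x) ^+ 2)^-1).
  by apply: smR_inv => // x /f0; rewrite -sqnorm_gt0 => /gt_eqF->.
split; first by apply: (smR_ext (smR_mul f1 f4)) => x _ /=; rewrite cReV.
by apply: (smR_ext (smR_opp (smR_mul f2 f4))) => x _ /=; rewrite cImV.
Qed.

Lemma smC_csqrt U f : smC U f -> (forall x, U x -> 0 < cRe (f x)) ->
  smC U (fun x => csqrt (f x)).
Proof.
move=> sf f0; have s1 := smR_sqnorm sf; have [f1 f2] := sf.
have s2 : smR U (fun x => Num.sqrt (cRe (f x) ^+ 2 + cIm (f x) ^+ 2)).
  by apply: (smR_sqrt s1) => x /f0 /cRe_gt0_neq0; rewrite sqnorm_gt0.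
have s3 : smR U (fun x => Num.sqrt ((Num.sqrt (cRe (f x) ^+ 2 + cIm (f x) ^+ 2) + cRe
  (f x)) / 2)).
  apply: (smR_sqrt (smR_mul (smR_add s2 f1) (smR_cst U (2^-1)))) => x /f0 fx.
  by rewrite divr_gt0 // ltr_wpDl // sqrtr_ge0.
split; first exact: s3.
apply: (smR_mul f2 (smR_inv (smR_mul (smR_cst U 2) s3) _)) => x /f0 /csqrt_Re_gt0 fx.
by rewrite mulf_neq0 // gt_eqF.
Qed.

Lemma open_neq0 U f : open U -> smC U f -> open (U `&` [set x | f x != 0]).
Proof.
move=> oU sf; have := open_smR_gt0 oU (smR_sqnorm sf).
by under eq_set do rewrite sqnorm_gt0.
Qed.

Lemma open_Re_gt0 U f : open U -> smC U f -> open (U `&` [set x | 0 < cRe (f x)]).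
Proof. by move=> oU [sf _]; exact: open_smR_gt0. Qed.

Lemma smC_sum U I (r : seq I) (P : pred I) (f : I -> 'rV[R]_N -> C) :
  (forall i, P i -> smC U (f i)) -> smC U (fun x => \sum_(i <- r | P i) f i x).
Proof.
move=> sf; elim: r => [|i r IH].
  by apply: smC_ext (smC_cst _ 0) _ => x _; rewrite big_nil.
apply: (@smC_ext _ (fun x => (if P i then f i x else 0) + \sum_(j <- r | P j) f j x)).
  apply: smC_add => //; case Pi: (P i); [exact: sf | exact: smC_cst].
by move=> x _; rewrite big_cons; case: ifP; rewrite ?add0r.
Qed.

Lemma smC_prod U I (r : seq I) (P : pred I) (f : I -> 'rV[R]_N -> C) :
  (forall i, P i -> smC U (f i)) -> smC U (fun x => \prod_(i <- r | P i) f i x).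
Proof.
move=> sf; elim: r => [|i r IH].
  by apply: smC_ext (smC_cst _ 1) _ => x _; rewrite big_nil.
apply: (@smC_ext _ (fun x => (if P i then f i x else 1) * \prod_(j <- r | P j) f j x)).
  apply: smC_mul => //; case Pi: (P i); [exact: sf | exact: smC_cst].
by move=> x _; rewrite big_cons; case: ifP; rewrite ?mul1r.
Qed.

Definition smM m n U (A : 'rV[R]_N -> 'M[C]_(m, n)) :=
  forall i j, smC U (fun x => A x i j).

Lemma smM_cst m n U (A : 'M[C]_(m, n)) : smM U (fun=> A).
Proof. by move=> i j; exact: smC_cst. Qed.

Lemma smM_mul m n p U (A : 'rV[R]_N -> 'M[C]_(m, n)) (B : 'rV[R]_N -> 'M[C]_(n, p)) :
  smM U A -> smM U B -> smM U (fun x => A x *m B x).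
Proof.
move=> sA sB i j; apply: (@smC_ext _ (fun x => \sum_k A x i k * B x k j)).
  by apply: smC_sum => k _; exact: smC_mul.
by move=> x _; rewrite mxE.
Qed.

Lemma smM_add m n U (A B : 'rV[R]_N -> 'M[C]_(m, n)) :
  smM U A -> smM U B -> smM U (fun x => A x + B x).
Proof.
move=> sA sB i j; apply: smC_ext (smC_add (sA i j) (sB i j)) _ => x _.
by rewrite mxE.
Qed.

Lemma smM_tr m n U (A : 'rV[R]_N -> 'M[C]_(m, n)) :
  smM U A -> smM U (fun x => (A x)^T).
Proof. by move=> sA i j; apply: smC_ext (sA j i) _ => x _; rewrite mxE. Qed.

Lemma smM_scale m n U f (A : 'rV[R]_N -> 'M[C]_(m, n)) :
  smC U f -> smM U A -> smM U (fun x => f x *: A x).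
Proof.
by move=> sf sA i j; apply: smC_ext (smC_mul sf (sA i j)) _ => x _; rewrite mxE.
Qed.

Lemma smC_det n U (A : 'rV[R]_N -> 'M[C]_n) :
  smM U A -> smC U (fun x => \det (A x)).
Proof.
move=> sA; apply: smC_sum => s _; apply: smC_mul; first exact: smC_cst.
by apply: smC_prod => i _; exact: sA.
Qed.

(** Cramer's formula: cofactors are determinants, hence polynomials in the entries. *)
Lemma smM_inv n U (A : 'rV[R]_N -> 'M[C]_n) : smM U A ->
  (forall x, U x -> \det (A x) != 0) -> smM U (fun x => invmx (A x)).
Proof.
move=> sA A0 i j.
have sadj : smM U (fun x => \adj (A x)).
  move=> k l; apply: (@smC_ext _ (fun x => cofactor (A x) l k)); last first.
    by move=> x _; rewrite mxE.
  apply: smC_mul; first exact: smC_cst.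
  apply: smC_det => a b; apply: smC_ext (sA (lift l a) (lift k b)) _ => x _.
  by rewrite !mxE.
apply: smC_ext (smM_scale (smC_inv (smC_det sA) A0) sadj i j) _ => x Ux.
by rewrite /invmx unitmxE unitfE A0.
Qed.

End ComplexSmooth.

(** * Complex symmetric matrices *)

Section SymmetricForms.
Context {R : realType}.
Local Notation C := (R[i]).

(** If v D v^T vanished for all v, polarization (2 is invertible) would kill the bilinear form of D,
    and its values on basis vectors are the entries of D. *)
Lemma symmetric_form_aniso n (D : 'M[C]_n) : D^T = D -> D != 0 ->
  exists v : 'rV_n, (v *m D *m v^T) 0 0 != 0.
Proof.
move=> sD; apply: contra_neqP => /forallNP H.
have {}H (v : 'rV[C]_n) : v *m D *m v^T = 0.
  by apply/matrixP => i j; rewrite (ord1 i) (ord1 j) [RHS]mxE; apply/eqP/negPn/negP;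
    exact: H.
have B (u v : 'rV[C]_n) : u *m D *m v^T = 0.
  have := H (u + v); rewrite linearD /= !(mulmxDl, mulmxDr) !H add0r addr0.
  have -> : v *m D *m u^T = u *m D *m v^T.
    have T (x : 'M[C]_1) : x^T = x by apply/matrixP => i j; rewrite (ord1 i) (ord1 j) mxE.
    by rewrite -[LHS]T !trmx_mul trmxK sD mulmxA.
  move=> E; apply/matrixP => i j; move/matrixP: E => /(_ i j).
  by rewrite !mxE -mulr2n => /eqP; rewrite mulrn_eq0 /= => /eqP.
apply/matrixP => i j; have := B (delta_mx 0 i) (delta_mx 0 j).
move=> /matrixP/(_ 0 0); rewrite trmx_delta -rowE -colE !mxE => ->.
by [].
Qed.

(** Gram-Schmidt by induction on n: a vector v is scaled by a complex square root so that v D v^T =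
    1, and the rows of K form a basis of its D-orthogonal complement. Stacking v on K makes D
    block-diagonal, and induction applies to the lower block. *)
Lemma symmetric_congr1 n (D : 'M[C]_n) : D^T = D -> D \in unitmx ->
  exists2 P, P \in unitmx & P *m D *m P^T = 1%:M.
Proof.
elim: n D => [|n IH] D sD uD.
  by exists 1%:M; [exact: unitmx1 | apply/matrixP => -[]].
have D0 : D != 0.
  apply: contraTneq uD => ->; rewrite unitmxE det0 unitfE eqxx //.
have [v0 v0D] := symmetric_form_aniso sD D0.
pose s := sqrtc ((v0 *m D *m v0^T) 0 0).
have s2 : s ^+ 2 = (v0 *m D *m v0^T) 0 0 by exact: sqr_sqrtc.
have sn : s != 0 by rewrite -sqrf_eq0 s2.
pose v := s^-1 *: v0; pose w := D *m v^T.
have vw : v *m w = 1%:M.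
  apply/matrixP => i j; rewrite (ord1 i) (ord1 j) /w mulmxA /v linearZ /= -!scalemxAl
    -scalemxAr.
  by rewrite 2![in LHS]mxE -s2 mxE eqxx expr2 mulKf ?mulVf.
have wn : w != 0.
  apply/eqP => w0; move: vw; rewrite w0 mulmx0 => /matrixP/(_ 0 0)/eqP.
  by rewrite !mxE eqxx eq_sym oner_eq0.
have [K fK Kw] : exists2 K : 'M[C]_(n, n.+1), row_free K & K *m w = 0.
  have rk : \rank (kermx w) = n.
    rewrite mxrank_ker -mxrank_tr.
    by rewrite rank_rV (can2_eq (@trmxK _ _ _) (@trmxK _ _ _)) trmx0 wn subn1.
  (* The number of rows of [row_base] is the rank itself; abstracting it as m lets the equation with
     n be substituted in the type. *)
  have H m : \rank (kermx w) = m ->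
      exists2 K : 'M[C]_(m, n.+1), row_free K & K *m w = 0.
    move=> <-; exists (row_base (kermx w)); first exact: row_base_free.
    by apply/sub_kermxP; rewrite eq_row_base.
  exact: H.
have wT : w^T = v *m D.
  by rewrite /w trmx_mul trmxK sD.
pose P : 'M[C]_(1 + n, n.+1) := col_mx v K.
have PDP : P *m D *m P^T = block_mx 1%:M 0 0 (K *m D *m K^T).
  rewrite /P mul_col_mx tr_col_mx mul_col_row; congr block_mx.
  - by rewrite -mulmxA.
  - by rewrite -wT -trmx_mul Kw trmx0.
  - by rewrite -mulmxA.
have uP : P \in unitmx.
  rewrite -row_free_unit; apply/inj_row_free => u uP0.
  have uE : u *m P = lsubmx u *m v + rsubmx u *m K.
    by rewrite -mul_row_col hsubmxK.
  have l0 : lsubmx u = 0.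
    have /(congr1 (mulmx^~ w)) := uP0; rewrite mul0mx uE mulmxDl -!mulmxA Kw.
    by rewrite mulmx0 addr0 vw mulmx1.
  have r0 : rsubmx u = 0.
    apply/eqP; rewrite -(mulmx_free_eq0 _ fK).
    by move: uP0; rewrite uE l0 mul0mx add0r => ->.
  by rewrite -[u]hsubmxK l0 r0 row_mx0.
have uD' : K *m D *m K^T \in unitmx.
  have : P *m D *m P^T \in unitmx.
    by rewrite !unitmx_mul unitmx_tr uP uD.
  by rewrite PDP !unitmxE det_ublock det1 mul1r.
have sD' : (K *m D *m K^T)^T = K *m D *m K^T by rewrite !trmx_mul trmxK sD mulmxA.
have [P' uP' P'E] := IH _ sD' uD'.
pose B : 'M[C]_(1 + n) := block_mx 1%:M 0 0 P'.
have uB : B \in unitmx by rewrite unitmxE det_ublock det1 mul1r -unitmxE.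
have BE : B *m (P *m D *m P^T) *m B^T = 1%:M.
  rewrite PDP /B tr_block_mx !trmx0 trmx1 !mulmx_block.
  rewrite !(mulmx0, mul0mx, mulmx1, mul1mx, addr0, add0r) P'E.
  by rewrite -scalar_mx_block.
exists (B *m P : 'M[C]_n.+1); first by rewrite unitmx_mul; apply/andP; split.
by rewrite trmx_mul -BE !mulmxA.
Qed.

Lemma symmetric_eq_mulmx_tr n (D : 'M[C]_n) : D^T = D -> D \in unitmx ->
  exists2 A, A \in unitmx & D = A *m A^T.
Proof.
move=> sD uD; have [P uP PE] := symmetric_congr1 sD uD.
exists (invmx P); first by rewrite unitmx_inv.
by rewrite trmx_inv -[invmx P]mulmx1 -PE !mulmxA mulVmx // mul1mx mulmxK ?unitmx_tr.
Qed.

End SymmetricForms.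

(** * Pencils of ternary quadratic forms, the form q and the Cholesky factor *)

Section Matrices3.
Context {R : realType}.
Local Notation C := (R[i]).

Definition i0 : 'I_3 := @Ordinal 3 0 isT.
Definition i1 : 'I_3 := @Ordinal 3 1 isT.
Definition i2 : 'I_3 := @Ordinal 3 2 isT.

Lemma ord3P (P : 'I_3 -> Prop) : P i0 -> P i1 -> P i2 -> forall i, P i.
Proof.
move=> P0 P1 P2 [[|[|[|//]]] Hi].
- by rewrite (_ : Ordinal Hi = i0) //; exact: val_inj.
- by rewrite (_ : Ordinal Hi = i1) //; exact: val_inj.
- by rewrite (_ : Ordinal Hi = i2) //; exact: val_inj.
Qed.

Lemma sum3E (V : nmodType) (f : 'I_3 -> V) : \sum_i f i = f i0 + f i1 + f i2.
Proof.
rewrite !big_ord_recl big_ord0 addr0 addrA.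
by congr (f _ + f _ + f _); exact: val_inj.
Qed.

Lemma det3E (F : comNzRingType) (A : 'M[F]_3) : \det A =
  A i0 i0 * (A i1 i1 * A i2 i2 - A i1 i2 * A i2 i1)
  - A i0 i1 * (A i1 i0 * A i2 i2 - A i1 i2 * A i2 i0)
  + A i0 i2 * (A i1 i0 * A i2 i1 - A i1 i1 * A i2 i0).
Proof.
(* Entries are indexed by naturals, so that the lifted ordinals of the cofactor expansion compute to
   numerals and [ring] recognizes equal entries. *)
have [a aE] : exists a : nat -> nat -> F, forall i j, A i j = a i j.
  by exists (fun i j => A (inord i) (inord j)) => i j; rewrite !inord_val.
rewrite (expand_det_row _ i0) sum3E /cofactor !(expand_det_row _ ord0).
rewrite !big_ord_recl !big_ord0 /cofactor !det_mx11 !mxE !aE /= /bump /=; ring.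
Qed.

(* The coefficient of t in det (t A + B). *)
Definition mixdet (A B : 'M[C]_3) : C :=
  A i0 i0 * (B i1 i1 * B i2 i2 - B i1 i2 * B i2 i1)
  - A i0 i1 * (B i1 i0 * B i2 i2 - B i1 i2 * B i2 i0)
  + A i0 i2 * (B i1 i0 * B i2 i1 - B i1 i1 * B i2 i0)
  + B i0 i0 * (A i1 i1 * B i2 i2 + B i1 i1 * A i2 i2
               - A i1 i2 * B i2 i1 - B i1 i2 * A i2 i1)
  - B i0 i1 * (A i1 i0 * B i2 i2 + B i1 i0 * A i2 i2
               - A i1 i2 * B i2 i0 - B i1 i2 * A i2 i0)
  + B i0 i2 * (A i1 i0 * B i2 i1 + B i1 i0 * A i2 i1
               - A i1 i1 * B i2 i0 - B i1 i1 * A i2 i0).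

Lemma det_pencilE (A B : 'M[C]_3) :
  \det ('X *: map_mx polyC A + map_mx polyC B) =
  (\det A)%:P * 'X^3 + (mixdet B A)%:P * 'X^2 + (mixdet A B)%:P * 'X
  + (\det B)%:P.
Proof.
by rewrite !det3E /mixdet !mxE; ring.
Qed.

Lemma sigmaE (A B : 'M[C]_3) :
  [/\ sigma A B 0 = \det B, sigma A B 1 = mixdet A B & sigma A B 2 = mixdet B A].
Proof.
by rewrite /sigma det_pencilE !coefD !coefCM !coefXn !coefX !coefC /=;
  rewrite !(mulr0, mulr1, addr0, add0r).
Qed.

(* The left-hand side of the equation of [tildeC]. *)
Definition dualform (D A : 'M[C]_3) : C :=
  - mixdet A D ^+ 2 + 4%:R * \det D * mixdet D A.

Lemma dualformE (D A : 'M[C]_3) :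
  - sigma A D 1%N ^+ 2 + 4%:R * sigma A D 0%N * sigma A D 2%N = dualform D A.
Proof. by have [-> -> ->] := sigmaE A D. Qed.

(** Congruence by P acts on the whole pencil, since t P A P^T + P D P^T = P (t A + D) P^T. Each
    sigma is thus multiplied by (det P)^2, and q is quadratic in the sigma. *)
Lemma dualform_congr (P D A : 'M[C]_3) :
  dualform (P *m D *m P^T) (P *m A *m P^T) = \det P ^+ 4 * dualform D A.
Proof.
have s i : sigma (P *m A *m P^T) (P *m D *m P^T) i = \det P ^+ 2 * sigma A D i.
  rewrite /sigma -coefCM.
  have -> : 'X *: map_mx polyC (P *m A *m P^T) + map_mx polyC (P *m D *m P^T) =
      map_mx polyC P *m ('X *: map_mx polyC A + map_mx polyC D) *m map_mx polyC P^T.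
    by rewrite !map_mxM mulmxDr mulmxDl -scalemxAr -scalemxAl.
  by rewrite !det_mulmx !det_map_mx det_tr mulrAC -rmorphM.
by rewrite -!dualformE !s; ring.
Qed.

Lemma mixdetZ (k l : C) (A B : 'M[C]_3) :
  mixdet (k *: A) (l *: B) = k * l ^+ 2 * mixdet A B.
Proof. by rewrite /mixdet !mxE; ring. Qed.

Lemma dualformZ (k l : C) (D A : 'M[C]_3) :
  dualform (l *: D) (k *: A) = l ^+ 4 * k ^+ 2 * dualform D A.
Proof. by rewrite /dualform !mixdetZ detZ; ring. Qed.

Definition dualbil (D A B : 'M[C]_3) : C :=
  dualform D (A + B) - dualform D A - dualform D B.

Lemma mixdetDl (A A' B : 'M[C]_3) z :
  mixdet (A + z *: A') B = mixdet A B + z * mixdet A' B.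
Proof. by rewrite /mixdet !mxE; ring. Qed.

Lemma mixdetDr (A B B' : 'M[C]_3) z :
  mixdet A (B + z *: B') = mixdet A B
   + z * (mixdet A (B + B') - mixdet A B - mixdet A B') + z ^+ 2 * mixdet A B'.
Proof. by rewrite /mixdet !mxE; ring. Qed.

Lemma dualformD (D A B : 'M[C]_3) z :
  dualform D (A + z *: B) =
  dualform D A + z * dualbil D A B + z ^+ 2 * dualform D B.
Proof.
have E : mixdet (A + B) D = mixdet A D + mixdet B D.
  by rewrite -[B]scale1r mixdetDl scale1r mul1r.
by rewrite /dualbil /dualform mixdetDr mixdetDl E; ring.
Qed.

Lemma dualbilC (D A B : 'M[C]_3) : dualbil D A B = dualbil D B A.
Proof. by rewrite /dualbil [B + A]addrC; ring. Qed.

Lemma dualbilDr (D A B B' : 'M[C]_3) z :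
  dualbil D A (B + z *: B') = dualbil D A B + z * dualbil D A B'.
Proof.
rewrite /dualbil /dualform /mixdet !mxE; ring.
Qed.

Lemma dualformZr (k : C) (D A : 'M[C]_3) :
  dualform D (k *: A) = k ^+ 2 * dualform D A.
Proof. by rewrite -[D]scale1r dualformZ expr1n mul1r scale1r. Qed.

Lemma dualbil0 (D A : 'M[C]_3) : dualbil D A 0 = 0.
Proof.
by rewrite /dualbil addr0 subrr sub0r -(scale0r A) dualformZr expr0n mul0r oppr0.
Qed.

Lemma dualbil_diag (D A : 'M[C]_3) : dualbil D A A = 2 * dualform D A.
Proof. by rewrite /dualbil -mulr2n -scaler_nat dualformZr; ring. Qed.

Lemma dualbil_congr (P D A B : 'M[C]_3) :
  dualbil (P *m D *m P^T) (P *m A *m P^T) (P *m B *m P^T) =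
  \det P ^+ 4 * dualbil D A B.
Proof.
by rewrite /dualbil -mulmxDl -mulmxDr !dualform_congr; ring.
Qed.

(** The second bracket is the sum of the principal 2 x 2 minors, so the value is (tr A)^2 - 2
    tr(A^2). *)
Lemma dualform1E (A : 'M[C]_3) : dualform 1%:M A =
  - (A i0 i0 + A i1 i1 + A i2 i2) ^+ 2
  + 4%:R * (A i0 i0 * A i1 i1 - A i0 i1 * A i1 i0 + A i0 i0 * A i2 i2
            - A i0 i2 * A i2 i0 + A i1 i1 * A i2 i2 - A i1 i2 * A i2 i1).
Proof. by rewrite /dualform det1 /mixdet !mxE /=; ring. Qed.

Lemma dualbil1E (A B : 'M[C]_3) : dualbil 1%:M A B =
  - 2 * (A i0 i0 + A i1 i1 + A i2 i2) * (B i0 i0 + B i1 i1 + B i2 i2)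
  + 4 * (A i0 i0 * B i1 i1 + B i0 i0 * A i1 i1 - A i0 i1 * B i1 i0 - B i0 i1 * A i1 i0
       + A i0 i0 * B i2 i2 + B i0 i0 * A i2 i2 - A i0 i2 * B i2 i0 - B i0 i2 * A i2 i0
       + A i1 i1 * B i2 i2 + B i1 i1 * A i2 i2 - A i1 i2 * B i2 i1 - B i1 i2 * A i2 i1).
Proof. by rewrite /dualbil !dualform1E !mxE; ring. Qed.

(* The coordinates of a symmetric matrix, in the order of [conic_coord]. *)
Definition sym_row (a : 'I_6) : nat := nth 0%N [:: 0; 0; 0; 1; 1; 2]%N a.
Definition sym_col (a : 'I_6) : nat := nth 0%N [:: 0; 1; 2; 1; 2; 2]%N a.

Definition sym_coord (A : 'M[C]_3) (a : 'I_6) : C :=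
  A (inord (sym_row a)) (inord (sym_col a)).

Definition sym_idx (i j : 'I_3) : 'I_6 :=
  inord (nth 0%N (nth [::] [:: [:: 0; 1; 2]; [:: 1; 3; 4]; [:: 2; 4; 5]] i) j)%N.

Definition sym_mx (x : 'I_6 -> C) : 'M[C]_3 := \matrix_(i, j) x (sym_idx i j).

Lemma conic_coordE (p : conic R) a : conic_coord p a = sym_coord (conic_mx p) a.
Proof.
rewrite /conic_coord /sym_coord /sym_row /sym_col.
by case: a => -[|[|[|[|[|[|//]]]]]].
Qed.

Lemma inord3E : (inord 0 = i0) * (inord 1 = i1) * (inord 2 = i2).
Proof. by split; [split|]; apply: val_inj; rewrite /= inordK. Qed.

Lemma sym_mx_tr x : (sym_mx x)^T = sym_mx x.
Proof.
by apply/matrixP; do 2!apply: ord3P; rewrite !mxE.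
Qed.

Lemma sym_mxK x a : sym_coord (sym_mx x) a = x a.
Proof.
rewrite /sym_coord mxE; congr x; apply: val_inj.
by case: a => -[|[|[|[|[|[|//]]]]]] Ha;
  rewrite /sym_row /sym_col /= ?inord3E /sym_idx /= inordK.
Qed.

Lemma sym_coordK A : A^T = A -> sym_mx (sym_coord A) = A.
Proof.
move=> sA; have E i j : A i j = A j i by rewrite -[in LHS]sA mxE.
apply/matrixP; do 2!apply: ord3P;
  rewrite mxE /sym_coord /sym_idx /sym_row /sym_col /= inordK //= !inord3E //.
Qed.

Lemma sym_coordZ k A a : sym_coord (k *: A) a = k * sym_coord A a.
Proof. by rewrite /sym_coord mxE. Qed.

(** The polar form is 2 tr A tr B - 4 tr(A B). Testing against the symmetric elementary matrices
    yields -8 A k l off the diagonal and 2 tr A - 4 A k k on it. *)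
Lemma dualbil1_nondegenerate A : A^T = A ->
  (forall B, B^T = B -> dualbil 1%:M A B = 0) -> A = 0.
Proof.
move=> sA H; have E i j : A i j = A j i by rewrite -[in LHS]sA mxE.
pose T k l : 'M[C]_3 := 
    \matrix_(i, j) if (i == k) && (j == l) || (i == l) && (j == k) then 1 else 0.
have {}H k l : dualbil 1%:M A (T k l) = 0.
  by apply: H; apply/matrixP => i j;
    rewrite !mxE orbC [(i == l) && _]andbC [(i == k) && _]andbC.
move: (H i0 i1) (H i0 i2) (H i1 i2) (H i0 i0) (H i1 i1) (H i2 i2).
rewrite !dualbil1E !mxE /= (E i1 i0) (E i2 i0) (E i2 i1).
have n8 : (8 : C) != 0 by rewrite pnatr_eq0.
have n4 : (4 : C) != 0 by rewrite pnatr_eq0.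
move=> h01 h02 h12 h00 h11 h22.
have cancel (k x : C) : k != 0 -> k * x = 0 -> x = 0.
  by move=> k0 /eqP; rewrite mulf_eq0 (negPf k0) => /eqP.
have a01 : A i0 i1 = 0 by apply: (cancel 8) => //; rewrite -[RHS]oppr0 -h01; ring.
have a02 : A i0 i2 = 0 by apply: (cancel 8) => //; rewrite -[RHS]oppr0 -h02; ring.
have a12 : A i1 i2 = 0 by apply: (cancel 8) => //; rewrite -[RHS]oppr0 -h12; ring.
(* The three diagonal equations add up to 6 tr A - 4 tr A = 2 tr A. *)
have tr0 : A i0 i0 + A i1 i1 + A i2 i2 = 0.
  apply: (cancel 2); first by rewrite pnatr_eq0.
  by have := congr2 +%R (congr2 +%R h00 h11) h22; rewrite !addr0 => <-; ring.
have a00 : A i0 i0 = 0.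
  apply: (cancel 4) => //.
  have -> : 4 * A i0 i0 = 2 * (A i0 i0 + A i1 i1 + A i2 i2) - 0 by rewrite -h00; ring.
  by rewrite tr0 mulr0 subr0.
have a11 : A i1 i1 = 0.
  apply: (cancel 4) => //.
  have -> : 4 * A i1 i1 = 2 * (A i0 i0 + A i1 i1 + A i2 i2) - 0 by rewrite -h11; ring.
  by rewrite tr0 mulr0 subr0.
have a22 : A i2 i2 = 0 by move: tr0; rewrite a00 a11 !add0r.
apply/matrixP; do 2!apply: ord3P; rewrite [RHS]mxE //.
- by rewrite E.
- by rewrite E.
- by rewrite E.
Qed.

(** Writing D = P P^T moves the claim to D = 1 by equivariance. The factor P need not vary smoothly
    here, as D is fixed. *)
Lemma dualbil_nondegenerate D A : D^T = D -> \det D != 0 -> A^T = A ->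
  (forall B, B^T = B -> dualbil D A B = 0) -> A = 0.
Proof.
move=> sD D0 sA H.
have uD : D \in unitmx by rewrite unitmxE unitfE.
have [P uP DE] := symmetric_eq_mulmx_tr sD uD.
have dP : \det P ^+ 4 != 0 by rewrite expf_neq0 // -unitfE -unitmxE.
pose A' := invmx P *m A *m (invmx P)^T.
have AE : A = P *m A' *m P^T.
  by rewrite /A' trmx_inv !mulmxA mulmxV // mul1mx mulmxKV // unitmx_tr.
suff A0 : A' = 0 by rewrite AE A0 mulmx0 mul0mx.
apply: dualbil1_nondegenerate => [|B sB].
  by rewrite /A' !trmx_mul trmxK sA mulmxA.
have sB' : (P *m B *m P^T)^T = P *m B *m P^T by rewrite !trmx_mul trmxK sB mulmxA.
move: (H _ sB'); rewrite {1}AE DE.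
have -> : P *m P^T = P *m 1%:M *m P^T by rewrite mulmx1.
rewrite dualbil_congr.
by move/eqP; rewrite mulf_eq0 (negPf dP) => /eqP.
Qed.


(* Cholesky factorization, expressed through square roots of the leading
   principal minors. *)
Definition minor2 (A : 'M[C]_3) := A i0 i0 * A i1 i1 - A i0 i1 ^+ 2.

Definition chol (A : 'M[C]_3) : 'M[C]_3 :=
  let r1 := csqrt (A i0 i0) in
  let r2 := csqrt (minor2 A) in
  let r3 := csqrt (\det A) in
  \matrix_(i, j) nth 0 (nth [::] [::
    [:: r1; 0; 0];
    [:: A i0 i1 / r1; r2 / r1; 0];
    [:: A i0 i2 / r1; (A i1 i2 - A i0 i1 * A i0 i2 / r1 ^+ 2) * r1 / r2; r3 / r2]] i) j.

(** A neighbourhood of the identity on which the three radicands stay in the half-plane where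
    [csqrt] is smooth. *)
Definition cholesky_dom (A : 'M[C]_3) : Prop :=
  [/\ 0 < complex.Re (A i0 i0), 0 < complex.Re (minor2 A) & 0 < complex.Re (\det A)].

Lemma cholK A : A^T = A -> cholesky_dom A -> chol A *m (chol A)^T = A.
Proof.
move=> sA [d1 d2 d3]; have E i j : A i j = A j i by rewrite -[in LHS]sA mxE.
have := (csqrtK d1, csqrtK d2, csqrtK d3).
have := (cRe_gt0_neq0 (csqrt_Re_gt0 d1), cRe_gt0_neq0 (csqrt_Re_gt0 d2),
  cRe_gt0_neq0 (csqrt_Re_gt0 d3)).
rewrite {d1 d2 d3} /chol.
move: (csqrt (A i0 i0)) (csqrt (minor2 A)) (csqrt (\det A)) =>
  r1 r2 r3 [[n1 n2] n3] [[e1 e2] e3].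
(* Solving the minors for the diagonal entries A11 and A22 leaves r1, r2, r3 and the off-diagonal
   entries as free variables; each entry of the product is then a rational identity. *)
have a11 : A i1 i1 = (r2 ^+ 2 + A i0 i1 ^+ 2) / r1 ^+ 2.
  by rewrite e2 /minor2 -e1; field.
have a22 : A i2 i2 = (r3 ^+ 2 + r1 ^+ 2 * A i1 i2 ^+ 2
   - 2 * A i0 i1 * A i0 i2 * A i1 i2 + A i1 i1 * A i0 i2 ^+ 2) / r2 ^+ 2.
  rewrite e3 det3E (E i1 i0) (E i2 i0) (E i2 i1) -e1 a11.
  by field; rewrite n1 n2.
apply/matrixP; do 2!apply: ord3P; rewrite mxE sum3E !mxE /=
  ?(E i1 i0) ?(E i2 i0) ?(E i2 i1) ?a22 ?a11 -?e1; by field; rewrite ?n1 ?n2.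
Qed.

Lemma det_chol_neq0 A : A^T = A -> cholesky_dom A -> \det (chol A) != 0.
Proof.
move=> sA dA; have [_ _ d3] := dA; move/cRe_gt0_neq0: d3.
by rewrite -[in X in X -> _](cholK sA dA) det_mulmx mulf_eq0 negb_or => /andP[].
Qed.

End Matrices3.

(** * Charts of the space of conics *)

Section Conics.
Local Open Scope quotient_scope.
Context {R : realType}.
Local Notation C := (R[i]).

Lemma conic_mx_nzsym (p : conic R) : nzsym R (conic_mx p).
Proof. by apply: set_mem; rewrite /conic_mx; exact: valP. Qed.

Lemma conic_mx_tr (p : conic R) : (conic_mx p)^T = conic_mx p.
Proof. by have [] := conic_mx_nzsym p. Qed.

Lemma nzsym1 : nzsym R 1%:M.
Proof. by split; [rewrite trmx1 | rewrite oner_neq0]. Qed.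

Definition nz_of (A : 'M[C]_3) (h : nzsym R A) : nzsym R := SigSub (mem_set h).

(* Junk value [\pi 1] outside [nzsym]. *)
Definition conic_of (A : 'M[C]_3) : conic R :=
  if pselect (nzsym R A) is left h then \pi_(conic R) (nz_of h)
  else \pi_(conic R) (nz_of nzsym1).

Lemma conic_of_pi (A : nzsym R) : conic_of (set_val A) = \pi_(conic R) A.
Proof.
rewrite /conic_of; case: pselect => [h|[]]; last exact: set_mem (valP A).
by congr (\pi_(_) _); apply: val_inj.
Qed.

Lemma conic_mxK (p : conic R) : conic_of (conic_mx p) = p.
Proof. by rewrite conic_of_pi reprK. Qed.

Lemma conic_of_eq (A B : 'M[C]_3) k : nzsym R A -> k != 0 -> B = k *: A ->
  conic_of B = conic_of A.
Proof.
move=> hA k0 BE.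
have hB : nzsym R B.
  by case: hA => sA A0; split; rewrite BE ?linearZ /= ?sA // scaler_eq0 negb_or k0.
have -> : A = set_val (nz_of hA) by [].
have -> : B = set_val (nz_of hB) by [].
rewrite !conic_of_pi; apply/eqmodP; rewrite /= proportional_sym; apply/asboolP.
by exists k.
Qed.

(** [repr] returns some matrix of the class of A, hence the unknown scalar k; later uses cancel it
    by homogeneity. *)
Lemma conic_ofK (A : 'M[C]_3) : nzsym R A ->
  exists2 k, k != 0 & conic_mx (conic_of A) = k *: A.
Proof.
move=> hA; have -> : A = set_val (nz_of hA) by [].
rewrite conic_of_pi.
have : \pi_(conic R) (repr (\pi_(conic R) (nz_of hA))) = \pi_(conic R) (nz_of hA).
  exact: reprK.
move=> /eqmodP; rewrite /= proportional_sym => /asboolP[k k0 kE].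
by exists k.
Qed.

Definition cplx_coord (u : 'rV[R]_(5 + 5)) (b : 'I_5) : C :=
  u 0 (lshift 5 b) +i* u 0 (rshift 5 b).

Definition hom_coord (a : 'I_6) (z : 'I_5 -> C) (k : 'I_6) : C :=
  if unlift a k is Some b then z b else 1.

(** The representative whose homogeneous coordinate a is 1. Unlike [conic_mx], it depends smoothly
    on the chart coordinates. *)
Definition aff_mx (a : 'I_6) (u : 'rV[R]_(5 + 5)) : 'M[C]_3 :=
  sym_mx (hom_coord a (cplx_coord u)).

Definition aff_coord (a : 'I_6) (A : 'M[C]_3) : 'rV[R]_(5 + 5) :=
  row_mx (\row_b complex.Re (sym_coord A (lift a b) / sym_coord A a))
         (\row_b complex.Im (sym_coord A (lift a b) / sym_coord A a)).

Lemma affine_chartE a (p : conic R) : chart_map (affine_chart a) p =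
  aff_coord a (conic_mx p).
Proof.
by congr row_mx; apply/rowP => b; rewrite !mxE /= !conic_coordE.
Qed.

Lemma affine_chart_domE a (p : conic R) :
  chart_dom (affine_chart a) p = (sym_coord (conic_mx p) a != 0) :> Prop.
Proof. by rewrite /= conic_coordE. Qed.

Lemma cplx_coord_aff a A b :
  cplx_coord (aff_coord a A) b = sym_coord A (lift a b) / sym_coord A a.
Proof.
rewrite /cplx_coord row_mxEl row_mxEr !mxE.
by case: (_ / _).
Qed.

Lemma aff_coordK a A : A^T = A -> sym_coord A a != 0 ->
  A = sym_coord A a *: aff_mx a (aff_coord a A).
Proof.
move=> sA Aa; rewrite -[LHS]sym_coordK //; apply/matrixP => i j; rewrite !mxE.
rewrite /hom_coord; case: unliftP => [b ->|->]; last by rewrite mulr1.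
by rewrite cplx_coord_aff mulrC divfK.
Qed.

Lemma aff_coordZ a k A : k != 0 -> aff_coord a (k *: A) = aff_coord a A.
Proof.
move=> k0; have E b : sym_coord (k *: A) (lift a b) / sym_coord (k *: A) a =
    sym_coord A (lift a b) / sym_coord A a.
  by rewrite !sym_coordZ invfM mulrACA divff // mul1r.
by congr row_mx; apply/rowP => b; rewrite !mxE E.
Qed.

Lemma aff_mx_tr a u : (aff_mx a u)^T = aff_mx a u.
Proof. exact: sym_mx_tr. Qed.

Lemma sym_coord_aff_mx a u : sym_coord (aff_mx a u) a = 1.
Proof. by rewrite sym_mxK /hom_coord unlift_none. Qed.

Lemma aff_mx_nzsym a u : nzsym R (aff_mx a u).
Proof.
split; first exact: aff_mx_tr.
apply/eqP => /(congr1 (sym_coord^~ a)); rewrite sym_coord_aff_mx /sym_coord mxE.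
by apply/eqP; rewrite oner_neq0.
Qed.

Lemma aff_mxK a u : aff_coord a (aff_mx a u) = u.
Proof.
rewrite /aff_coord sym_coord_aff_mx; apply/rowP => k.
by rewrite mxE; case: splitP => b kb; rewrite mxE divr1 sym_mxK /hom_coord liftK /=;
  congr (u _ _); apply: val_inj.
Qed.

Lemma nzsym_coord (A : 'M[C]_3) : nzsym R A -> exists a, sym_coord A a != 0.
Proof.
move=> [sA A0]; apply/existsP; apply: contraNT A0 => /existsPn H.
rewrite -(sym_coordK sA); apply/eqP/matrixP => i j; rewrite !mxE.
by apply/eqP; move: (H (sym_idx i j)); rewrite negbK.
Qed.

Lemma smM_aff_mx N (U : set 'rV[R]_N) a (g : 'rV[R]_N -> 'rV[R]_(5 + 5)) :
  smV U g -> smM U (fun x => aff_mx a (g x)).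
Proof.
move=> sg i j; apply: (@smC_ext _ _ _ (fun x =>
  hom_coord a (cplx_coord (g x)) (sym_idx i j))).
  rewrite /hom_coord; case: unliftP => [b _|_]; last exact: smC_cst.
  by split; exact: sg.
by move=> x _; rewrite mxE.
Qed.

Lemma smV_row_mx N m n (U : set 'rV[R]_N) (f : 'rV[R]_N -> 'rV[R]_m) (g : 'rV[R]_N ->
  'rV[R]_n) :
  smV U f -> smV U g -> smV U (fun x => row_mx (f x) (g x)).
Proof.
move=> sf sg k; case: (split_ordP k) => b ->.
  by apply: smR_ext (sf b) _ => x _; rewrite row_mxEl.
by apply: smR_ext (sg b) _ => x _; rewrite row_mxEr.
Qed.

Lemma smV_aff_coord N (U : set 'rV[R]_N) a (A : 'rV[R]_N -> 'M[C]_3) :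
  smM U A -> (forall x, U x -> sym_coord (A x) a != 0) ->
  smV U (fun x => aff_coord a (A x)).
Proof.
move=> sA A0.
have s b : smC U (fun x => sym_coord (A x) (lift a b) / sym_coord (A x) a).
  by apply: smC_mul; [exact: sA | apply: smC_inv => //; exact: sA].
by apply: smV_row_mx => b; [have [s1 _] := s b; apply: smR_ext s1 _ |
  have [_ s1] := s b; apply: smR_ext s1 _] => x _; rewrite mxE.
Qed.

Lemma smV_id N (U : set 'rV[R]_N) : smV U id.
Proof. by move=> j; exact: smR_coord. Qed.

Lemma smV_lsubmx N m n (U : set 'rV[R]_N) (f : 'rV[R]_N -> 'rV[R]_(m + n)) :
  smV U f -> smV U (fun x => lsubmx (f x)).
Proof. by move=> sf j; apply: smR_ext (sf (lshift n j)) _ => x _; rewrite mxE. Qed.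

Lemma smV_rsubmx N m n (U : set 'rV[R]_N) (f : 'rV[R]_N -> 'rV[R]_(m + n)) :
  smV U f -> smV U (fun x => rsubmx (f x)).
Proof. by move=> sf j; apply: smR_ext (sf (rshift m j)) _ => x _; rewrite mxE. Qed.

End Conics.

(** * Slice charts *)

Section Straightening.
Context {R : realType}.
Local Notation C := (R[i]).

(** Straightening makes the equation a pair of coordinates at positions i and j, while a slice chart
    wants the vanishing coordinates last; a permutation moves them there. *)
Lemma perm2_exists N (l1 l2 i j : 'I_N) : l1 != l2 -> i != j ->
  exists s : {perm 'I_N}, s l1 = i /\ s l2 = j.
Proof.
move=> l12 ij; pose m := tperm l1 i l2.
exists (tperm l1 i * tperm m j)%g; rewrite !permM tpermL -/m tpermL; split=> //.
rewrite tpermD //; last by rewrite eq_sym.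
by rewrite /m -[X in _ != X](tpermL l1 i) (inj_eq perm_inj) eq_sym.
Qed.

(** The affine charts store real and imaginary parts in separate blocks, so a complex variable sits
    at two arbitrary positions i and j. *)
Definition set_pair N (i j : 'I_N) (x : 'rV[R]_N) (w : C) : 'rV[R]_N :=
  \row_k if k == i then complex.Re w else if k == j then complex.Im w else x 0 k.

Definition get_pair N (i j : 'I_N) (x : 'rV[R]_N) : C := x 0 i +i* x 0 j.

Lemma set_pairK N (i j : 'I_N) x w : i != j -> get_pair i j (set_pair i j x w) = w.
Proof.
rewrite /get_pair !mxE eqxx eq_sym => /negPf->; rewrite eqxx.
by case: w.
Qed.

Lemma get_pairK N (i j : 'I_N) x : set_pair i j x (get_pair i j x) = x.
Proof. by apply/rowP => k; rewrite mxE; case: eqP => [->//|_]; case: eqP => [->|]. Qed.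

Lemma set_pair_set_pair N (i j : 'I_N) x w w' : set_pair i j (set_pair i j x w) w' =
  set_pair i j x w'.
Proof. by apply/rowP => k; rewrite !mxE; case: eqP => // _; case: eqP. Qed.

Lemma smV_set_pair N (i j : 'I_N) (U : set 'rV[R]_N) (w : 'rV[R]_N -> C) :
  smC U w -> smV U (fun x => set_pair i j x (w x)).
Proof.
move=> [s1 s2] k.
apply: (@smR_ext _ _ _ (fun x => if k == i then complex.Re (w x)
  else if k == j then complex.Im (w x) else x 0 k)); last by move=> x _; rewrite mxE.
by case: (k == i) => //; case: (k == j) => //; exact: smR_coord.
Qed.

(** With [Prop] for T, this also says that a set is a cylinder along the two coordinates. *)
Definition indep_pair N T (i j : 'I_N) (f : 'rV[R]_N ->
  T) := forall x w, f (set_pair i j x w) = f x.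

(* Near a zero where [2 al z + be <> 0], the value w of the quadratic polynomial
   [al z^2 + be z + ga] can replace z as a coordinate. With z = z0 + y and
   [w = al y^2 + b y + c], the inverse is [y = - 2 (c - w) / (delta + b)] where
   delta is the branch of [sqrt (b^2 - 4 al (c - w))] near delta0; this form of
   the root needs no assumption on [al]. *)
Lemma quadratic_straightening N (i j : 'I_N) (U : set 'rV[R]_N)
    (al be ga : 'rV[R]_N -> C) (x0 : 'rV[R]_N) :
  i != j -> open U -> U x0 -> indep_pair i j U ->
  smC U al -> smC U be -> smC U ga ->
  indep_pair i j al -> indep_pair i j be -> indep_pair i j ga ->
  2 * al x0 * get_pair i j x0 + be x0 != 0 ->
  exists (O O' : set 'rV[R]_N) (phi psi : 'rV[R]_N -> 'rV[R]_N),
  [/\ [/\ open O, O x0 & O `<=` U], open O', smV O phi, smV O' psi &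
   [/\ (forall x, O x -> O' (phi x) /\ psi (phi x) = x),
       (forall x, O' x -> O (psi x) /\ phi (psi x) = x) &
       forall x, phi x = set_pair i j x
          (al x * get_pair i j x ^+ 2 + be x * get_pair i j x + ga x)]].
Proof.
move=> ij oU Ux0 iU sal sbe sga ial ibe iga d0n.
set d0 := _ + _ in d0n; pose z0 := get_pair i j x0.
pose z := get_pair i j : 'rV[R]_N -> C.
have sz V : smC V z by exact: smC_coord.
pose b x := 2 * al x * z0 + be x.
pose c x := al x * z0 ^+ 2 + be x * z0 + ga x.
pose f x := al x * z x ^+ 2 + be x * z x + ga x.
pose d x := 2 * al x * z x + be x.
have ib : indep_pair i j b by move=> x w; rewrite /b ial ibe.
have ic : indep_pair i j c by move=> x w; rewrite /c ial ibe iga.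
(* On the target side the coordinate z x holds the value w, so this is the discriminant of al y^2 +
   b y + (c - w). *)
pose disc x := b x ^+ 2 - 4 * al x * (c x - z x).
have smul2 V (g : 'rV[R]_N -> C) k : smC V g -> smC V (fun x => k * g x).
  by move=> sg; apply: smC_mul => //; exact: smC_cst.
have ssqr V (g : 'rV[R]_N -> C) : smC V g -> smC V (fun x => g x ^+ 2).
  by move=> sg; exact: smC_mul.
have sdivd V (g : 'rV[R]_N -> C) k : smC V g -> smC V (fun x => g x / k).
  by move=> sg; apply: smC_mul => //; exact: smC_cst.
have sd : smC U d.
  by apply: smC_add => //; apply: smC_mul => //; exact: smul2.
have sb : smC U b.
  by apply: smC_add => //; apply: smC_mul; [exact: smul2 | exact: smC_cst].
have sc : smC U c.
  by apply: smC_add => //; apply: smC_add; apply: smC_mul => //; exact: smC_cst.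
have sf : smC U f.
  by apply: smC_add => //; apply: smC_add; apply: smC_mul => //; exact: ssqr.
have sdisc : smC U disc.
  apply: smC_add; first exact: ssqr.
  apply: smC_opp; apply: smC_mul; first exact: smul2.
  by apply: smC_add => //; exact: smC_opp.
(* Both b and d equal d0 at x0, so dividing by d0 puts the base point at 1, well inside the
   half-plane. The condition on the square makes d / d0 the principal root of (d / d0)^2. *)
pose O := U `&` [set x | 0 < complex.Re (b x / d0)]
   `&` [set x | 0 < complex.Re (d x / d0)] `&` [set x | 0 < complex.Re ((d x / d0) ^+ 2)].
pose O1 := U `&` [set x | 0 < complex.Re (b x / d0)].
pose O' := O1 `&` [set x | 0 < complex.Re (disc x / d0 ^+ 2)].
have oO1 : open O1 by apply: open_Re_gt0 => //; exact: sdivd.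
have oO : open O.
  apply: open_Re_gt0; [apply: open_Re_gt0 => //|apply: ssqr]; apply: sdivd;
  by apply: smC_sub sd => x []; try case.
have O'U : O' `<=` U by move=> x [[]].
have oO' : open O'.
  by apply: open_Re_gt0 => //; apply: sdivd; apply: smC_sub sdisc => x [].
pose del x := d0 * csqrt (disc x / d0 ^+ 2).
have sdel : smC O' del.
  apply: smul2; apply: smC_csqrt; first by apply: sdivd; exact: smC_sub O'U sdisc.
  by move=> x [].
have delb x : 0 < complex.Re (b x / d0) -> 0 < complex.Re (disc x / d0 ^+ 2) ->
    del x + b x != 0.
  move=> h1 h2; have : del x / d0 + b x / d0 != 0.
    apply: cRe_gt0_neq0; rewrite cReD addr_gt0 // /del mulrC mulKf //.
    exact: csqrt_Re_gt0.
  by rewrite -mulrDl mulf_eq0 negb_or => /andP[].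
pose y x := - 2 * (c x - z x) / (del x + b x).
pose phi x := set_pair i j x (f x).
pose psi x := set_pair i j x (z0 + y x).
have zset x w : z (set_pair i j x w) = w by exact: set_pairK.
have phiP x : O x -> O' (phi x) /\ psi (phi x) = x.
  move=> [[[Ux bx] dx] d2x].
  (* The discriminant of a quadratic polynomial is the square of its derivative at a root: y = z -
     z0 is a root of al y^2 + b y + c - f, with derivative d. *)
  have discE : disc (phi x) = d x ^+ 2.
    by rewrite /disc /phi ib ial ic zset /b /c /f /d; ring.
  have dphi : 0 < complex.Re (disc (phi x) / d0 ^+ 2).
    by move: d2x; rewrite /= discE expr_div_n.
  have bphi : 0 < complex.Re (b (phi x) / d0) by rewrite /phi ib.
  split; first by split=> //; split=> //; rewrite /phi iU.
  rewrite /psi /phi set_pair_set_pair -/(phi x).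
  suff -> : z0 + y (phi x) = get_pair i j x by rewrite get_pairK.
  have delE : del (phi x) = d x.
    rewrite /del (@csqrt_unique _ _ (d x / d0)) //; first by rewrite mulrC divfK.
    by rewrite discE expr_div_n.
  have := delb _ bphi dphi; rewrite delE.
  rewrite /y delE /phi ic ib zset -/(z x) => n.
  apply: (@mulIf _ (d x + b x)) => //.
  by rewrite mulrDl divfK // /c /f /d /b; ring.
have psiP x : O' x -> O (psi x) /\ phi (psi x) = x.
  move=> [[Ux bx] dx].
  have n := delb _ bx dx.
  have del2 : del x ^+ 2 = disc x.
    by rewrite exprMn csqrtK // mulrC divfK // expf_neq0.
  have dE : d (psi x) = del x.
    rewrite /d /psi ial ibe zset /y; apply: (@mulIf _ (del x + b x)) => //.
    transitivity (b x * (del x + b x) + disc x - b x ^+ 2); last by rewrite -del2; ring.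
    rewrite /disc [X in X * _ = _](_ : _ =
      b x + 2 * al x * (- 2 * (c x - z x) / (del x + b x))); last by rewrite /b; ring.
    by field.
  have dd : d (psi x) / d0 = csqrt (disc x / d0 ^+ 2) by rewrite dE /del mulrC mulKf.
  have h := csqrt_Re_gt0 dx.
  split.
    split; last by rewrite /= dd csqrtK.
    split; last by rewrite /= dd.
    by split; [rewrite /psi iU | rewrite /= /psi ib].
  rewrite /phi {1}/psi set_pair_set_pair.
  suff -> : f (psi x) = z x by rewrite get_pairK.
  rewrite /f /psi ial ibe iga zset.
  have yE : y x * (del x + b x) = - 2 * (c x - z x) by rewrite /y divfK.
  (* The rationalized root satisfies the usual quadratic formula, in a form without division by
     al. *)
  have y2 : 2 * al x * y x = del x - b x.
    by move: dE; rewrite /d /psi ial ibe zset => <-; rewrite /b; ring.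
  have n2 : (2 : C) != 0 by rewrite pnatr_eq0.
  apply: (mulfI n2).
  transitivity (2 * c x + y x * (2 * al x * y x + 2 * b x)); first by rewrite /c /b; ring.
  rewrite y2 (_ : del x - b x + 2 * b x = del x + b x); last by ring.
  by rewrite yE; ring.
exists O, O', phi, psi; split=> //.
- split=> //; last by move=> x [[[]]].
  have one : d x0 / d0 = 1 by rewrite /d /z -/d0 divff.
  have one' : b x0 / d0 = 1 by rewrite -one.
  by split; [split; [split|]|] => //=; rewrite ?one ?one' ?expr1n ltr01.
- by apply: smV_set_pair; apply: smC_sub sf => x [[[]]].
- apply: smV_set_pair; apply: smC_add; first exact: smC_cst.
  apply: smC_mul.
    apply: smul2; apply: smC_add; first exact: smC_sub O'U sc.
    by apply: smC_opp.
  apply: smC_inv; last by move=> x [[_ bx] dx]; exact: delb.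
  by apply: smC_add => //; exact: smC_sub O'U sb.
Qed.

End Straightening.

Section Slices.
Context {R : realType}.
Local Notation C := (R[i]).

(* The data required by [embedded_submanifold], in a chart, for a zero locus. *)
Definition slice_at N (k : nat) (U : set 'rV[R]_N) (f : 'rV[R]_N -> C) (x0 : 'rV[R]_N) :=
  exists (O O' : set 'rV[R]_N) (phi psi : 'rV[R]_N -> 'rV[R]_N),
  [/\ [/\ open O, O x0 & O `<=` U], [/\ open O', Coo O phi & Coo O' psi],
      (forall u, O u -> O' (phi u) /\ psi (phi u) = u) /\
      (forall v, O' v -> O (psi v) /\ phi (psi v) = v) &
      forall x, O x -> (f x = 0 <-> forall l : 'I_N, (k <= l)%N -> phi x ord0 l = 0)].

(** The straightened coordinate is f itself, so f = 0 means that its real and imaginary parts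
    vanish; the permutation s sends them to l1 and l2, the only positions from k on. *)
Lemma quadratic_slice N (k : nat) (l1 l2 i j : 'I_N) (U : set 'rV[R]_N)
    (al be ga : 'rV[R]_N -> C) (x0 : 'rV[R]_N) :
  l1 != l2 -> (forall l : 'I_N, (k <= l)%N = (l == l1) || (l == l2)) ->
  i != j -> open U -> U x0 -> indep_pair i j U ->
  smC U al -> smC U be -> smC U ga ->
  indep_pair i j al -> indep_pair i j be -> indep_pair i j ga ->
  2 * al x0 * get_pair i j x0 + be x0 != 0 ->
  slice_at k U (fun x => al x * get_pair i j x ^+ 2 + be x * get_pair i j x + ga x) x0.
Proof.
move=> l12 kl ij oU Ux0 iU sal sbe sga ial ibe iga d0n.
have := quadratic_straightening ij oU Ux0 iU sal sbe sga ial ibe iga d0n.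
move=> [V [V1 [phi [psi [[oV Vx0 VU] oV1 sphi spsi [phiP psiP phiE]]]]]].
have [s [s1 s2]] := perm2_exists l12 ij.
pose cp (t : {perm 'I_N}) (x : 'rV[R]_N) : 'rV[R]_N := \row_m x 0 (t m).
have cpK t x : cp t^-1%g (cp t x) = x.
  by apply/rowP => m; rewrite !mxE permKV.
have cpKV t x : cp t (cp t^-1%g x) = x.
  by apply/rowP => m; rewrite !mxE permK.
have scp W t : smV W (cp t).
  by move=> m; apply: (@smR_ext _ _ _ (fun x => x 0 (t m)));
    [exact: smR_coord|move=> x _; rewrite mxE].
have oV2 : open (cp s^-1%g @^-1` V1).
  have cc : continuous (cp s^-1%g).
    move=> x; apply: differentiable_continuous.
    exact: (smV_differentiable openT (scp setT s^-1%g) I).1.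
  by move/continuousP: cc; apply.
exists V, (cp s^-1%g @^-1` V1), (cp s \o phi), (psi \o cp s^-1%g); split=> //.
- split=> //; apply: smV_Coo => // m.
    by apply: smR_ext (sphi (s m)) _ => x _; rewrite /= mxE.
  exact: (smR_comp (@scp _ s^-1%g) _ (spsi m)).
- split=> [u Vu|v V1v] /=; first by rewrite cpK; exact: phiP.
  by have [? ->] := psiP _ V1v; rewrite cpKV.
- move=> x Vx; set w := (X in X = 0); rewrite /= phiE -/w.
  split=> [w0 l|H].
    rewrite kl => /orP[]/eqP->; rewrite !mxE ?s1 ?s2 ?eqxx ?w0 //.
    by rewrite eq_sym (negPf ij).
  apply: complexP.
    by have := H l1; rewrite kl eqxx => /(_ isT); rewrite !mxE s1 eqxx.
  have := H l2; rewrite kl eqxx orbT => /(_ isT); rewrite !mxE s2 eqxx.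
  by rewrite eq_sym (negPf ij).
Qed.

Definition unit_sym (k : 'I_6) : 'M[C]_3 := sym_mx (fun a => (a == k)%:R).

Lemma sym_mxE (x : 'I_6 -> C) : sym_mx x = \sum_k x k *: unit_sym k.
Proof.
apply/matrixP => i j; rewrite mxE summxE (bigD1 (sym_idx i j)) //= !mxE eqxx mulr1.
rewrite big1 ?addr0 // => k /negPf nk.
by rewrite !mxE eq_sym nk mulr0.
Qed.

Lemma dualbil_sum (D A : 'M[C]_3) (c : 'I_6 -> C) (E : 'I_6 -> 'M[C]_3) :
  dualbil D A (\sum_k c k *: E k) = \sum_k c k * dualbil D A (E k).
Proof.
elim/big_rec2: _ => [|k x B _ <-]; first exact: dualbil0.
by rewrite addrC dualbilDr addrC.
Qed.

Lemma smC_mixdet N (U : set 'rV[R]_N) (A B : 'rV[R]_N -> 'M[C]_3) :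
  smM U A -> smM U B -> smC U (fun x => mixdet (A x) (B x)).
Proof.
move=> sA sB; rewrite /mixdet; repeat first
 [ exact: sA | exact: sB | apply: smC_add | apply: smC_opp | apply: smC_mul ].
Qed.

Lemma smC_dualform N (U : set 'rV[R]_N) (D A : 'rV[R]_N -> 'M[C]_3) :
  smM U D -> smM U A -> smC U (fun x => dualform (D x) (A x)).
Proof.
move=> sD sA; rewrite /dualform; have sm := smC_mixdet sA sD; apply: smC_add.
  by apply: smC_opp; apply: smC_mul.
apply: smC_mul; last exact: smC_mixdet.
by apply: smC_mul; [exact: smC_cst | exact: smC_det].
Qed.

Lemma smC_dualbil N (U : set 'rV[R]_N) (D A B : 'rV[R]_N -> 'M[C]_3) :
  smM U D -> smM U A -> smM U B -> smC U (fun x => dualbil (D x) (A x) (B x)).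
Proof.
move=> sD sA sB; rewrite /dualbil; apply: smC_add.
  apply: smC_add; first by apply: smC_dualform => //; exact: smM_add.
  by apply: smC_opp; exact: smC_dualform.
by apply: smC_opp; exact: smC_dualform.
Qed.

(** Suppose all derivatives along the affine coordinates vanish. Euler's relation gives a zero
    derivative along the remaining coordinate a too, since that coordinate of [aff_mx] is 1. Then
    the nonzero matrix [aff_mx] would lie in the radical of the polar form. *)
Lemma dualform_submersion (D : 'M[C]_3) a u : D^T = D -> \det D != 0 ->
  dualform D (aff_mx a u) = 0 ->
  exists b, dualbil D (aff_mx a u) (unit_sym (lift a b)) != 0.
Proof.
move=> sD D0 q0; apply: contrapT => /forallNP H.
have {}H b : dualbil D (aff_mx a u) (unit_sym (lift a b)) = 0.
  by apply/eqP/negPn/negP; exact: H.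
have [_ /eqP] := aff_mx_nzsym a u; apply.
apply: (dualbil_nondegenerate sD D0 (aff_mx_tr a u)) => B sB.
rewrite -(sym_coordK sB) sym_mxE dualbil_sum big1 // => k _.
suff -> : dualbil D (aff_mx a u) (unit_sym k) = 0 by rewrite mulr0.
case: (unliftP a k) => [b ->|->] //.
(* Euler's relation: the polar form at (A, A) is 2 q_D (A) = 0, and its expansion over [unit_sym]
   retains only the term of index a. *)
have := dualbil_diag D (aff_mx a u); rewrite q0 mulr0 {2}/aff_mx sym_mxE dualbil_sum.
rewrite (bigD1 a) //= big1 ?addr0; last first.
  by move=> l; case: (unliftP a l) => [b ->|->]; rewrite ?H ?mulr0 ?eqxx.
by rewrite /hom_coord unlift_none mul1r.
Qed.

(** Stated once for both loci: e is the identity, with D constant, for the fiber; for the total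
    space e is the inclusion of the left block, and D depends on the right block. *)
Lemma dualform_slice N (k : nat) (l1 l2 : 'I_N) (e : 'I_(5 + 5) -> 'I_N)
    (U : set 'rV[R]_N) (D : 'rV[R]_N -> 'M[C]_3) a (x0 : 'rV[R]_N) :
  let g (x : 'rV[R]_N) : 'rV[R]_(5 + 5) := \row_k x 0 (e k) in
  l1 != l2 -> (forall l : 'I_N, (k <= l)%N = (l == l1) || (l == l2)) ->
  injective e -> open U -> U x0 -> smM U D -> (D x0)^T = D x0 -> \det (D x0) != 0 ->
  (forall k l, indep_pair (e k) (e l) U) -> (forall k l, indep_pair (e k) (e l) D) ->
  dualform (D x0) (aff_mx a (g x0)) = 0 ->
  slice_at k U (fun x => dualform (D x) (aff_mx a (g x))) x0.
Proof.
move=> g l12 kl ie oU Ux0 sD symD D0 iU iD q0.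
have [b hb] := dualform_submersion symD D0 q0.
pose i := e (lshift 5 b); pose j := e (rshift 5 b).
have ij : i != j by rewrite (inj_eq ie) eq_lrshift.
(* The matrix A with its coordinate z of index [lift a b] replaced by 0: A is affine in z, hence q_D
   (A) is quadratic in z. *)
pose h x k := if k == lift a b then 0 else hom_coord a (cplx_coord (g x)) k.
have zE x : cplx_coord (g x) b = get_pair i j x by rewrite /cplx_coord !mxE.
have affE x : aff_mx a (g x) = sym_mx (h x) + get_pair i j x *: unit_sym (lift a b).
  apply/matrixP => r s; rewrite !mxE /h; case: eqP => [->|_]; last by rewrite mulr0 addr0.
  by rewrite mulr1 add0r /hom_coord liftK zE.
have ih : indep_pair i j (fun x => sym_mx (h x)).
  move=> x w; congr sym_mx; apply/funext => l; rewrite /h; case: eqP => // lab.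
  rewrite /hom_coord; case: unliftP => [b' lE|//].
  have b'b : b' != b by apply: contra_notN lab => /eqP <-.
  rewrite /cplx_coord !mxE !(inj_eq ie) eq_lrshift eq_rlshift.
  by rewrite (inj_eq (@lshift_inj _ _)) (inj_eq (@rshift_inj _ _)) (negPf b'b).
have sh : smM U (fun x => sym_mx (h x)).
  move=> r s; apply: (@smC_ext _ _ _ (fun x => h x (sym_idx r s))); last by move=> x _;
    rewrite mxE.
  rewrite /h; case: (_ == _); first exact: smC_cst.
  rewrite /hom_coord; case: unliftP => [b' _|_]; last exact: smC_cst.
  apply: (@smC_ext _ _ _ (get_pair (e (lshift 5 b')) (e (rshift 5 b'))));
    first exact: smC_coord.
  by move=> x _; rewrite /cplx_coord !mxE.
pose al x := dualform (D x) (unit_sym (lift a b)).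
pose be x := dualbil (D x) (sym_mx (h x)) (unit_sym (lift a b)).
pose ga x := dualform (D x) (sym_mx (h x)).
have E x : dualform (D x) (aff_mx a (g x)) =
    al x * get_pair i j x ^+ 2 + be x * get_pair i j x + ga x.
  by rewrite affE dualformD /al /be /ga; ring.
have -> : (fun x => dualform (D x) (aff_mx a (g x))) =
    (fun x => al x * get_pair i j x ^+ 2 + be x * get_pair i j x + ga x) by apply/funext.
apply: (quadratic_slice l12 kl ij) => //; rewrite /al /be /ga.
- exact: iU.
- by apply: smC_dualform => //; exact: smM_cst.
- by apply: smC_dualbil => //; exact: smM_cst.
- exact: smC_dualform.
- by move=> x w; rewrite iD.
- by move=> x w; rewrite iD ih.
- by move=> x w; rewrite iD ih.
(* The derivative 2 al z + be is the polar form at A in the direction of z, nonzero by the choice of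
   b. *)
- suff -> : 2 * dualform (D x0) (unit_sym (lift a b)) * get_pair i j x0 +
    dualbil (D x0) (sym_mx (h x0)) (unit_sym (lift a b)) =
    dualbil (D x0) (aff_mx a (g x0)) (unit_sym (lift a b)) by [].
  by rewrite affE [RHS]dualbilC dualbilDr dualbil_diag [in RHS]dualbilC; ring.
Qed.

End Slices.

(** * The three submanifolds and the projection *)

Section Submanifolds.
Context {R : realType}.
Local Notation C := (R[i]).

(** The model fiber, lying over the conic x^2 + y^2 + z^2 = 0, whose matrix is the identity up to a
    scalar. *)
Definition fiber1 : set (CP5 R) := [set p | dualform 1%:M (conic_mx p) = 0].

Lemma chart_image a u : exists2 p, chart_dom (affine_chart a) p &
  chart_map (affine_chart a) p = u :> 'rV[R]_(5 + 5).
Proof.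
exists (conic_of (aff_mx a u)).
  rewrite affine_chart_domE; have [k k0 ->] := conic_ofK (aff_mx_nzsym a u).
  by rewrite sym_coordZ sym_coord_aff_mx mulr1.
rewrite affine_chartE; have [k k0 ->] := conic_ofK (aff_mx_nzsym a u).
by rewrite aff_coordZ // aff_mxK.
Qed.

Lemma conic_mx_chart a (p : conic R) : chart_dom (affine_chart a) p ->
  conic_mx p = sym_coord (conic_mx p) a *: aff_mx a (chart_map (affine_chart a) p).
Proof.
rewrite affine_chart_domE affine_chartE => pa; apply: aff_coordK => //.
exact: conic_mx_tr.
Qed.

Lemma dualform_chart a b (p q : conic R) :
  chart_dom (affine_chart a) p -> chart_dom (affine_chart b) q ->
  dualform (conic_mx q) (conic_mx p) = 0 <->
  dualform (aff_mx b (chart_map (affine_chart b) q)) (aff_mx a (chart_map (affine_chart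
    a) p)) = 0.
Proof.
move=> pa qb; rewrite {1}(conic_mx_chart pa) {1}(conic_mx_chart qb) dualformZ.
move: pa qb; rewrite !affine_chart_domE => pa qb.
split=> [/eqP|->]; last by rewrite mulr0.
by rewrite mulf_eq0 mulf_eq0 !expf_eq0 /= (negPf pa) (negPf qb) => /eqP.
Qed.

Lemma fiber1_chart a (p : CP5 R) : chart_dom (affine_chart a) p ->
  fiber1 p <-> dualform 1%:M (aff_mx a (chart_map (affine_chart a) p)) = 0.
Proof.
move=> pa; rewrite /fiber1 /= {1}(conic_mx_chart pa) dualformZr.
move: pa; rewrite affine_chart_domE => pa.
split=> [/eqP|->]; last by rewrite mulr0.
by rewrite mulf_eq0 expf_eq0 /= (negPf pa) => /eqP.
Qed.

Lemma det_chart b (q : conic R) : chart_dom (affine_chart b) q ->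
  (\det (conic_mx q) != 0) = (\det (aff_mx b (chart_map (affine_chart b) q)) != 0).
Proof.
move=> qb; rewrite {1}(conic_mx_chart qb) detZ mulf_eq0 expf_eq0 /=.
by move: qb; rewrite affine_chart_domE => /negPf->.
Qed.

Lemma chart_exists (p : conic R) : exists a, chart_dom (affine_chart a) p.
Proof.
have [a pa] := nzsym_coord (conic_mx_nzsym p).
by exists a; rewrite affine_chart_domE.
Qed.

Lemma tildeCE (p q : CP5 R) : tildeC R (p, q) <->
  \det (conic_mx q) != 0 /\ dualform (conic_mx q) (conic_mx p) = 0.
Proof. by rewrite -dualformE. Qed.

Lemma open_det_aff N b (g : 'rV[R]_N -> 'rV[R]_(5 + 5)) : smV setT g ->
  open [set x | \det (aff_mx b (g x)) != 0].
Proof.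
move=> sg; have sD := smC_det (smM_aff_mx b sg).
have := open_neq0 openT sD; by rewrite setTI.
Qed.

Lemma submanifold_nondeg : exists k, embedded_submanifold k (nondeg_conics R).
Proof.
(* An open subset has full dimension: no coordinate is required to vanish. *)
exists (5 + 5)%N; split=> // p p0; have [a pa] := chart_exists p.
exists (affine_chart a), [set u | \det (aff_mx a u) != 0],
  [set u | \det (aff_mx a u) != 0], id, id.
have oD : open [set u : 'rV[R]_(5 + 5) | \det (aff_mx a u) != 0].
  apply: (@open_det_aff _ _ id); exact: smV_id.
split=> //.
- by split=> //; exists a.
- split=> //; first by rewrite /= -det_chart.
  by move=> u _; have [q qa <-] := chart_image a u; exists q.
- by split=> //; apply: smV_Coo => //; exact: smV_id.
- move=> q qa; rewrite /= -(det_chart qa) => q0; split=> // _ j.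
  by rewrite leqNgt ltn_ord.
Qed.

Lemma submanifold_fiber1 : exists k, embedded_submanifold k fiber1.
Proof.
(* One complex equation removes two of the ten real dimensions. *)
exists 8; split=> // p p0; have [a pa] := chart_exists p.
set u0 := chart_map (affine_chart a) p.
have gE (x : 'rV[R]_(5 + 5)) : (\row_k x 0 k) = x by apply/rowP => k; rewrite mxE.
have p0' : dualform 1%:M (aff_mx a u0) = 0 by apply/(fiber1_chart pa).
pose l1 : 'I_(5 + 5) := @Ordinal (5 + 5) 8 isT.
pose l2 : 'I_(5 + 5) := @Ordinal (5 + 5) 9 isT.
have kl (l : 'I_(5 + 5)) : (8 <= l)%N = (l == l1) || (l == l2).
  by case: l => -[|[|[|[|[|[|[|[|[|[|//]]]]]]]]]].
have := @dualform_slice R (5 + 5) 8 l1 l2 id setT (fun=> 1%:M) a u0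
  isT kl (fun x y => id) openT I (smM_cst _ _) (trmx1 _ _).
rewrite det1 oner_neq0 gE => /(_ isT (fun _ _ _ _ => erefl) (fun _ _ _ _ => erefl) p0').
move=> [V [V1 [phi [psi [[oV Vu0 _] [oV1 cphi cpsi] inv fE]]]]].
exists (affine_chart a), V, V1, phi, psi; split=> //.
- by split=> //; exists a.
- by split=> // u _; have [q qa <-] := chart_image a u; exists q.
- by move=> q qa /fE <-; rewrite gE; exact: fiber1_chart.
Qed.

Lemma submanifold_tildeC : exists k, embedded_submanifold k (tildeC R).
Proof.
(* One complex equation removes two of the twenty real dimensions. *)
exists 18; split=> // -[p q] /tildeCE[q0 pq0].
have [a pa] := chart_exists p; have [b qb] := chart_exists q.
pose c : chart R (CP5 R * CP5 R) ((5 + 5) + (5 + 5)) :=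
  prod_chart (affine_chart a) (affine_chart b).
set x0 := chart_map c (p, q).
have gE (x : 'rV[R]_((5 + 5) + (5 + 5))) : (\row_k x 0 (lshift (5 + 5) k)) = lsubmx x.
  by apply/rowP => k; rewrite !mxE.
pose U := [set x : 'rV[R]_((5 + 5) + (5 + 5)) | \det (aff_mx b (rsubmx x)) != 0].
have sr W : smV W (fun x : 'rV[R]_((5 + 5) + (5 + 5)) => rsubmx x).
  exact: smV_rsubmx (@smV_id _ _ _).
have oU : open U by apply: (@open_det_aff _ _ (fun x => rsubmx x)); exact: sr.
pose l1 : 'I_((5 + 5) + (5 + 5)) := @Ordinal ((5 + 5) + (5 + 5)) 18 isT.
pose l2 : 'I_((5 + 5) + (5 + 5)) := @Ordinal ((5 + 5) + (5 + 5)) 19 isT.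
have kl (l : 'I_((5 + 5) + (5 + 5))) : (18 <= l)%N = (l == l1) || (l == l2).
  by case: l => -[|[|[|[|[|[|[|[|[|[|[|[|[|[|[|[|[|[|[|[|//]]]]]]]]]]]]]]]]]]]].
have rset k l x w : rsubmx (set_pair (lshift (5 + 5) k) (lshift (5 + 5) l) x w) =
  rsubmx x.
  by apply/rowP => m; rewrite !mxE !eq_rlshift.
have q0' : \det (aff_mx b (chart_map (affine_chart b) q)) != 0 by rewrite -det_chart.
have x0l : lsubmx x0 = chart_map (affine_chart a) p by rewrite row_mxKl.
have x0r : rsubmx x0 = chart_map (affine_chart b) q by rewrite row_mxKr.
have Ux0 : U x0 by rewrite /U /= x0r.
have := @dualform_slice R ((5 + 5) + (5 + 5)) 18 l1 l2 (@lshift (5 + 5) (5 + 5)) U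
  (fun x => aff_mx b (rsubmx x)) a x0 isT kl (@lshift_inj _ _) oU Ux0
  (smM_aff_mx b (sr U)) (aff_mx_tr _ _) Ux0.
have iU k l : indep_pair (lshift (5 + 5) k) (lshift (5 + 5) l) U.
  by move=> x w; rewrite /U /= rset.
have iD k l : indep_pair (lshift (5 + 5) k) (lshift (5 + 5) l)
    (fun x : 'rV[R]_((5 + 5) + (5 + 5)) => aff_mx b (rsubmx x)).
  by move=> x w; rewrite rset.
move=> /(_ iU iD); rewrite gE x0l x0r => /(_ ((dualform_chart pa qb).1 pq0)).
move=> [V [V1 [phi [psi [[oV Vu0 VU] [oV1 cphi cpsi] inv fE]]]]].
exists c, V, V1, phi, psi; split=> //.
- by split=> //; exists (affine_chart a), (affine_chart b); split=> //;
  [exists a | exists b].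
- split=> // u _.
  have [p' pa' pE] := chart_image a (lsubmx u).
  have [q' qb' qE] := chart_image b (rsubmx u).
  by exists (p', q') => //; rewrite -[RHS]hsubmxK -pE -qE.
- move=> [p' q'] [/= pa' qb'] Vy; rewrite -(fE _ Vy).
  (* Membership in U supplies the nondegeneracy of D, which is part of [tildeC] but not of the
     equation. *)
  have := VU _ Vy; rewrite /U /= gE row_mxKl row_mxKr -(det_chart qb') => Uy.
  by rewrite -(dualform_chart pa' qb') tildeCE; split=> [[]|].
Qed.

Lemma smooth_snd : smooth_map_on (N := CP5 R) (tildeC R) snd.
Proof.
move=> [p q] _; have [a pa] := chart_exists p; have [b qb] := chart_exists q.
exists (prod_chart (affine_chart a) (affine_chart b)), (affine_chart b), setT,
  (fun x : 'rV[R]_((5 + 5) + (5 + 5)) => rsubmx x).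
split=> //.
- split; last by exists b.
  by exists (affine_chart a), (affine_chart b); split=> //; [exists a | exists b].
- by split=> //; exact: openT.
- apply: smV_Coo; first exact: openT.
  exact: smV_rsubmx (@smV_id _ _ _).
- by move=> [p' q'] _ [_ qb'] _ /=; rewrite row_mxKr.
Qed.

End Submanifolds.

(** * Topology of the space of conics *)

Lemma continuous_mx_at (T U : topologicalType) m n (f : T -> 'M[U]_(m, n)) x :
  (forall i j, {for x, continuous (fun y => f y i j)}) -> {for x, continuous f}.
Proof.
move=> cf A [P Pf sPA].
have : \forall y \near x, forall i j, P i j (f y i j).
  by apply: filter_forall => i; apply: filter_forall => j; exact: (cf i j _ (Pf i j)).
by apply: filterS => y Py; exact: sPA.
Qed.

Section ComplexTopology.
Local Open Scope quotient_scope.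
Context {R : realType}.
Local Notation C := (R[i]).

Lemma cReB (x y : C) : complex.Re (x - y) = complex.Re x - complex.Re y.
Proof. by case: x; case: y. Qed.

Lemma cImB (x y : C) : complex.Im (x - y) = complex.Im x - complex.Im y.
Proof. by case: x; case: y. Qed.

(** The modulus, which defines the topology of [R[i]], dominates the absolute values of both
    parts. *)
Lemma nbhs_complex (x : C) (e : R) : 0 < e ->
  \forall y \near x, `|complex.Re y - complex.Re x| < e /\ `|complex.Im y - complex.Im
    x| < e.
Proof.
move=> e0; have eC : 0 < (e%:C : C) by rewrite ltcR.
have : \forall y \near (x : C^o), ball (x : C^o) (e%:C : C) y by exact: nbhsx_ballx.
apply: filterS => y; rewrite -ball_normE /= normc_def ltcR => h.
rewrite cReB cImB in h.
by split; apply: le_lt_trans h;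
  rewrite distrC -[leLHS]sqrtr_sqr ler_wsqrtr // ?lerDl ?lerDr sqr_ge0.
Qed.

Lemma continuous_cRe : continuous (@complex.Re R : C -> R).
Proof.
move=> x A /nbhs_ballP[e e0 sA]; have := nbhs_complex x e0.
by apply: filterS => y [h _]; apply: sA; rewrite -ball_normE /= distrC.
Qed.

Lemma continuous_cIm : continuous (@complex.Im R : C -> R).
Proof.
move=> x A /nbhs_ballP[e e0 sA]; have := nbhs_complex x e0.
by apply: filterS => y [_ h]; apply: sA; rewrite -ball_normE /= distrC.
Qed.

Lemma continuous_real_complex : continuous (fun t : R => (t%:C : C)).
Proof.
move=> t; suff : (fun t : R => (t%:C : C^o)) @ t --> (t%:C : C^o) by [].
apply/cvgrPdist_lt => e e0.
have er : (complex.Re e)%:C = e by rewrite RRe_real // gtr0_real.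
have e1 : 0 < complex.Re e by rewrite -ltcR er.
near=> s; rewrite -er -rmorphB normc_def /= expr0n addr0 ltcR sqrtr_sqr.
near: s; exact: (@cvgr_dist_lt _ _ _ _ _ id t cvg_id _ e1).
Unshelve. all: by end_near. Qed.

Lemma continuous_set_val_nz : continuous (@set_val _ (nzsym R)).
Proof. exact: initial_continuous. Qed.

Lemma continuous_sym_coord a : continuous (fun A : nzsym R => sym_coord (set_val A) a).
Proof.
move=> A; apply: (@continuous_comp _ _ _ set_val (fun M : 'M[C]_3 => sym_coord M a)).
  exact: continuous_set_val_nz.
exact: (@coord_continuous C 3 3).
Qed.

Lemma continuous_aff_coord a (A : nzsym R) : sym_coord (set_val A) a != 0 ->
  {for A, continuous (fun B : nzsym R => aff_coord a (set_val B))}.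
Proof.
move=> A0.
have cq b : {for A, continuous (fun B : nzsym R =>
    sym_coord (set_val B) (lift a b) / sym_coord (set_val B) a)}.
  apply: (@cvgM C _ (nbhs A)); first exact: continuous_sym_coord.
  by apply: (@cvgV C _ (nbhs A)) => //; exact: continuous_sym_coord.
apply: continuous_mx_at => i k; case: (split_ordP k) => b ->.
  have E : (fun B : nzsym R => aff_coord a (set_val B) i (lshift 5 b)) =
      @complex.Re R \o (fun B => sym_coord (set_val B) (lift a b) / sym_coord (set_val
        B) a).
    by apply/funext => B; rewrite (ord1 i) row_mxEl mxE.
  by rewrite E; apply: continuous_comp; [exact: cq | exact: continuous_cRe].
have E : (fun B : nzsym R => aff_coord a (set_val B) i (rshift 5 b)) =
    @complex.Im R \o (fun B => sym_coord (set_val B) (lift a b) / sym_coord (set_val B)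
      a).
  by apply/funext => B; rewrite (ord1 i) row_mxEr mxE.
by rewrite E; apply: continuous_comp; [exact: cq | exact: continuous_cIm].
Qed.

(** In the quotient topology, openness is tested on the preimage among nonzero symmetric matrices.
    There the condition is invariant under scaling, so it can be read on the matrix itself instead
    of on [conic_mx]. *)
Lemma open_chart_preimage a (V : set 'rV[R]_(5 + 5)) : open V ->
  open [set p : CP5 R | chart_dom (affine_chart a) p /\ V (chart_map (affine_chart a) p)].
Proof.
move=> oV.
rewrite (_ : mkset _ = [set p : CP5 R | sym_coord (conic_mx p) a != 0 /\
    V (aff_coord a (conic_mx p))]); last first.
  by apply/funext => p; rewrite /mkset affine_chartE affine_chart_domE.
suff : open [set A : nzsym R | sym_coord (set_val A) a != 0 /\ V (aff_coord a (set_val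
  A))].
  rewrite /open /= /quotient_open => oA.
  rewrite (_ : \pi_(conic R) @^-1` _ =
    [set A : nzsym R | sym_coord (set_val A) a != 0 /\ V (aff_coord a (set_val A))]) //.
  apply/seteqP; split=> A /=; rewrite -conic_of_pi;
    have [k k0 ->] := conic_ofK (set_mem (valP A));
    by rewrite sym_coordZ mulf_eq0 (negPf k0) aff_coordZ.
rewrite openE => A [A0 VA]; rewrite /interior /=.
apply: filterI; last by apply: (continuous_aff_coord A0);
  exact: open_nbhs_nbhs (conj oV VA).
exact: (cvgr_neq0 (sym_coord (set_val A) a) (@continuous_sym_coord a A) A0).
Qed.

End ComplexTopology.

(** * Local trivializations *)

Section Trivialization.
Context {R : realType}.
Local Notation C := (R[i]).

Definition congr_conic (G : 'M[C]_3) (p : CP5 R) : CP5 R :=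
  conic_of (G *m conic_mx p *m G^T).

Lemma congr_nzsym (G A : 'M[C]_3) : G \in unitmx -> nzsym R A -> nzsym R (G *m A *m G^T).
Proof.
move=> uG [sA A0]; split; first by rewrite !trmx_mul trmxK sA mulmxA.
apply: contra_neq A0 => /(congr1 (fun M => invmx G *m M *m invmx G^T)).
by rewrite mulmx0 mul0mx !mulmxA mulVmx // mul1mx mulmxK // unitmx_tr.
Qed.

Lemma congr_conicE (G A : 'M[C]_3) : G \in unitmx -> nzsym R A ->
  congr_conic G (conic_of A) = conic_of (G *m A *m G^T).
Proof.
move=> uG hA; have [k k0 kE] := conic_ofK hA.
apply: (@conic_of_eq _ _ _ k) => //; first exact: congr_nzsym.
by rewrite kE -scalemxAr -scalemxAl.
Qed.

Lemma congr_conicM (G H : 'M[C]_3) p : G \in unitmx -> H \in unitmx ->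
  congr_conic G (congr_conic H p) = congr_conic (G *m H) p.
Proof.
move=> uG uH.
have hH : nzsym R (H *m conic_mx p *m H^T) := congr_nzsym uH (conic_mx_nzsym p).
apply: (etrans (congr_conicE uG hH)).
by rewrite /congr_conic trmx_mul !mulmxA.
Qed.

Lemma congr_conic1 p : congr_conic 1%:M p = p.
Proof. by rewrite /congr_conic trmx1 mulmx1 mul1mx conic_mxK. Qed.

(** Expresses the action in charts through [aff_mx], that is, by a formula smooth in the
    coordinates. *)
Lemma congr_conic_chart a a' (G : 'M[C]_3) (p : CP5 R) : G \in unitmx ->
  chart_dom (affine_chart a) p ->
  let M := G *m aff_mx a (chart_map (affine_chart a) p) *m G^T in
  chart_dom (affine_chart a') (congr_conic G p) = (sym_coord M a' != 0) :> Prop /\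
  chart_map (affine_chart a') (congr_conic G p) = aff_coord a' M.
Proof.
move=> uG pa M; have pE := conic_mx_chart pa.
have hM : nzsym R M by apply: congr_nzsym => //; exact: aff_mx_nzsym.
rewrite affine_chart_domE in pa.
have E : congr_conic G p = conic_of M.
  apply: (@conic_of_eq _ _ _ _ hM pa).
  by rewrite [in LHS]pE -scalemxAr -scalemxAl.
rewrite affine_chart_domE affine_chartE E; have [k k0 kE] := conic_ofK hM.
split; first by rewrite kE (sym_coordZ k M a') mulf_eq0 (negPf k0).
by rewrite kE (aff_coordZ a' M k0).
Qed.

Lemma dualform_congr_conic (G D : 'M[C]_3) p : G \in unitmx ->
  dualform (G *m D *m G^T) (conic_mx (congr_conic G p)) = 0 <->
  dualform D (conic_mx p) = 0.
Proof.
move=> uG; have [k k0 ->] := conic_ofK (congr_nzsym uG (conic_mx_nzsym p)).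
have n : k ^+ 2 * \det G ^+ 4 != 0.
  by rewrite mulf_neq0 // expf_neq0 // -unitfE -unitmxE.
rewrite dualformZr dualform_congr mulrA; split=> [/eqP|->]; last by rewrite mulr0.
by rewrite mulf_eq0 (negPf n) => /eqP.
Qed.

Context (b : 'I_6) (P : 'M[C]_3) (uP : P \in unitmx).

(** Leading minors of a nondegenerate symmetric matrix may vanish, so the Cholesky formula is
    applied after the constant congruence by P, chosen to send the base point to the identity. *)
Definition sqdom : set 'rV[R]_(5 + 5) :=
  [set w | cholesky_dom (P *m aff_mx b w *m P^T)].

Definition sqmx (w : 'rV[R]_(5 + 5)) : 'M[C]_3 :=
  invmx P *m chol (P *m aff_mx b w *m P^T).

Lemma congr_aff_tr w : (P *m aff_mx b w *m P^T)^T = P *m aff_mx b w *m P^T.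
Proof. by rewrite !trmx_mul trmxK aff_mx_tr mulmxA. Qed.

Lemma sqmxK w : sqdom w -> sqmx w *m (sqmx w)^T = aff_mx b w.
Proof.
move=> hw; rewrite /sqmx trmx_mul !mulmxA -[_ *m chol _ *m _]mulmxA.
rewrite (cholK (congr_aff_tr w) hw) !mulmxA mulVmx // mul1mx.
by rewrite -mulmxA -trmx_mul mulVmx // trmx1 mulmx1.
Qed.

Lemma sqmx_unit w : sqdom w -> sqmx w \in unitmx.
Proof.
move=> hw; rewrite unitmx_mul unitmx_inv uP /= unitmxE unitfE.
exact: det_chol_neq0 (congr_aff_tr w) hw.
Qed.

Lemma smM_chol N (U : set 'rV[R]_N) (A : 'rV[R]_N -> 'M[C]_3) : smM U A ->
  (forall x, U x -> cholesky_dom (A x)) -> smM U (fun x => chol (A x)).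
Proof.
move=> sA dA.
have s1 : smC U (fun x => csqrt (A x i0 i0)).
  by apply: smC_csqrt => [|x /dA[]]; first exact: sA.
have s2 : smC U (fun x => csqrt (minor2 (A x))).
  apply: smC_csqrt => [|x /dA[]//]; apply: smC_add; first by apply: smC_mul; exact: sA.
  by apply: smC_opp; apply: smC_mul; exact: sA.
have s3 : smC U (fun x => csqrt (\det (A x))).
  by apply: smC_csqrt => [|x /dA[]//]; exact: smC_det.
have v1 : smC U (fun x => (csqrt (A x i0 i0))^-1).
  by apply: smC_inv => // x /dA[h _ _]; apply: cRe_gt0_neq0; exact: csqrt_Re_gt0.
have v2 : smC U (fun x => (csqrt (minor2 (A x)))^-1).
  by apply: smC_inv => // x /dA[_ h _]; apply: cRe_gt0_neq0; exact: csqrt_Re_gt0.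
have v3 : smC U (fun x => (csqrt (A x i0 i0) ^+ 2)^-1).
  apply: smC_inv; first exact: smC_mul.
  by move=> x /dA[h _ _]; rewrite expf_neq0 //; apply: cRe_gt0_neq0; exact: csqrt_Re_gt0.
have c0 := smC_cst U (0 : C).
do 2!apply: ord3P; (apply: smC_ext; last by move=> x _; rewrite mxE /=; reflexivity);
  repeat first [ exact: c0 | exact: s1 | exact: s2 | exact: s3 | exact: v1 | exact: v2
   | exact: v3 | exact: sA | apply: smC_add | apply: smC_opp | apply: smC_mul ].
Qed.

Lemma smM_congr_aff N (U : set 'rV[R]_N) (g : 'rV[R]_N -> 'rV[R]_(5 + 5)) :
  smV U g -> smM U (fun x => P *m aff_mx b (g x) *m P^T).
Proof.
move=> sg; apply: smM_mul; last exact: smM_cst.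
by apply: smM_mul; [exact: smM_cst | exact: smM_aff_mx].
Qed.

Lemma smM_sqmx N (U : set 'rV[R]_N) (g : 'rV[R]_N -> 'rV[R]_(5 + 5)) :
  smV U g -> (forall x, U x -> sqdom (g x)) -> smM U (fun x => sqmx (g x)).
Proof.
move=> sg Ug; apply: smM_mul; first exact: smM_cst.
by apply: smM_chol => //; exact: smM_congr_aff.
Qed.

Lemma open_sqdom N (g : 'rV[R]_N -> 'rV[R]_(5 + 5)) : smV setT g ->
  open [set x | sqdom (g x)].
Proof.
move=> sg; have sM := smM_congr_aff sg.
have o1 := open_Re_gt0 openT (sM i0 i0).
have sm2 : smC setT (fun x => minor2 (P *m aff_mx b (g x) *m P^T)).
  apply: smC_add; first by apply: smC_mul; exact: sM.
  by apply: smC_opp; apply: smC_mul; exact: sM.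
have o2 := open_Re_gt0 o1 (smC_sub (@subsetT _ _) sm2).
have o3 := open_Re_gt0 o2 (smC_sub (@subsetT _ _) (smC_det sM)).
move: o3; set B := (X in open X -> _).
suff -> : B = [set x | sqdom (g x)] by [].
by apply/seteqP; split=> x; [case=> [[[_ h1] h2] h3] | case].
Qed.

Definition sq_nbhs : set (CP5 R) :=
  [set q | chart_dom (affine_chart b) q /\ sqdom (chart_map (affine_chart b) q)].

Definition sq_of (q : CP5 R) : 'M[C]_3 := sqmx (chart_map (affine_chart b) q).

Lemma sq_of_unit q : sq_nbhs q -> sq_of q \in unitmx.
Proof. by case=> _; exact: sqmx_unit. Qed.

Lemma open_sq_nbhs : open sq_nbhs.
Proof.
apply: (@open_chart_preimage R b sqdom).
by apply: (@open_sqdom _ id); exact: smV_id.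
Qed.

(** The factors change order: the base is the second component of (C, D) but the first one of the
    product with the fiber. *)
Definition triv (x : CP5 R * CP5 R) : CP5 R * CP5 R :=
  (x.2, congr_conic (invmx (sq_of x.2)) x.1).

Definition triv_inv (y : CP5 R * CP5 R) : CP5 R * CP5 R :=
  (congr_conic (sq_of y.1) y.2, y.1).

Lemma trivK p q : sq_nbhs q -> triv_inv (triv (p, q)) = (p, q).
Proof.
move=> /sq_of_unit uq; rewrite /triv_inv /triv /= congr_conicM ?unitmx_inv //.
by rewrite mulmxV // congr_conic1.
Qed.

Lemma triv_invK q p : sq_nbhs q -> triv (triv_inv (q, p)) = (q, p).
Proof.
move=> /sq_of_unit uq; rewrite /triv_inv /triv /= congr_conicM ?unitmx_inv //.
by rewrite mulVmx // congr_conic1.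
Qed.

(** [sq_of q] factors the normalized matrix of q, which agrees with [conic_mx q] up to a nonzero
    scalar; homogeneity of q_D in D absorbs it. *)
Lemma fiber1_sq q p : sq_nbhs q ->
  dualform (conic_mx q) (conic_mx (congr_conic (sq_of q) p)) = 0 <-> fiber1 p.
Proof.
move=> hq; have [qb hw] := hq; rewrite /fiber1 /=.
rewrite -(dualform_congr_conic 1%:M p (sq_of_unit hq)) mulmx1 /sq_of sqmxK //.
rewrite [in X in X <-> _](conic_mx_chart qb) -[conic_mx (congr_conic _ _)]scale1r
  dualformZ.
move: qb; rewrite affine_chart_domE => q0; rewrite scale1r.
split=> [/eqP|->]; last by rewrite mulr0.
by rewrite expr1n mulr1 mulf_eq0 expf_eq0 /= (negPf q0) => /eqP.
Qed.

(** Smoothness holds with the second component ranging over all conics; the restriction to the model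
    fiber comes afterwards. In charts, A is a product of [smM] factors and represents the image
    conic. *)
Lemma smooth_triv_inv : smooth_map_on (M := prod_charted (CP5 R) (CP5 R))
  (N := prod_charted (CP5 R) (CP5 R)) (sq_nbhs `*` setT) triv_inv.
Proof.
move=> [q p] [/= hq _]; have [qb hw] := hq.
have [a pa] := chart_exists p; have [a' pa'] := chart_exists (congr_conic (sq_of q) p).
pose A (x : 'rV[R]_((5 + 5) + (5 + 5))) :=
  sqmx (lsubmx x) *m aff_mx a (rsubmx x) *m (sqmx (lsubmx x))^T.
pose U := [set x : 'rV[R]_((5 + 5) + (5 + 5)) | sqdom (lsubmx x)].
have sl W : smV W (fun x : 'rV[R]_((5 + 5) + (5 + 5)) => lsubmx x).
  exact: smV_lsubmx (@smV_id _ _ _).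
have sr W : smV W (fun x : 'rV[R]_((5 + 5) + (5 + 5)) => rsubmx x).
  exact: smV_rsubmx (@smV_id _ _ _).
have oU : open U by apply: (@open_sqdom _ (fun x => lsubmx x)); exact: sl.
have sA : smM U A.
  have sq : smM U (fun x => sqmx (lsubmx x)) by apply: smM_sqmx.
  by apply: smM_mul; [apply: smM_mul => //; exact: smM_aff_mx | exact: smM_tr].
(* The second condition keeps the image inside the chart a'. *)
pose V := U `&` [set x | sym_coord (A x) a' != 0].
have oV : open V by apply: open_neq0 => //; exact: sA.
have chartE q' p' : sq_nbhs q' -> chart_dom (affine_chart a) p' ->
   let x := row_mx (chart_map (affine_chart b) q') (chart_map (affine_chart a) p') in
   (chart_dom (affine_chart a') (congr_conic (sq_of q') p') <-> sym_coord (A x) a' !=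
     0) /\
   chart_map (affine_chart a') (congr_conic (sq_of q') p') = aff_coord a' (A x).
  move=> hq' pa0 x; rewrite /A row_mxKl row_mxKr.
  by have [-> ->] := congr_conic_chart a' (sq_of_unit hq') pa0.
exists (prod_chart (affine_chart b) (affine_chart a)),
  (prod_chart (affine_chart a') (affine_chart b)), V,
  (fun x => row_mx (aff_coord a' (A x)) (lsubmx x)).
split.
- by split; [exists (affine_chart b), (affine_chart a) | exists (affine_chart a'),
  (affine_chart b)];
    split=> //; eexists.
- by split.
- split; first exact: oV.
  split; first by rewrite /U /mkset row_mxKl.
  by apply/(chartE _ _ hq pa).1.
- apply: smV_Coo => //; apply: smV_row_mx; last exact: sl.
  by apply: smV_aff_coord => [i j|x []//]; apply: smC_sub (sA i j) => x [].
- move=> [q' p'] [/= hq' _] [/= qb' pa0] [_ h].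
  have [E1 E2] := chartE _ _ hq' pa0.
  split; first by split; [apply/E1; exact: h | exact: qb'].
  exact: (f_equal2 (fun u v => row_mx u v) E2 (esym (row_mxKl _ _))).
Qed.

Lemma smooth_triv : smooth_map_on (M := prod_charted (CP5 R) (CP5 R))
  (N := prod_charted (CP5 R) (CP5 R)) (setT `*` sq_nbhs) triv.
Proof.
move=> [p q] [_ /= hq]; have [qb hw] := hq.
have [a pa] := chart_exists p.
have [a' pa'] := chart_exists (congr_conic (invmx (sq_of q)) p).
pose A (x : 'rV[R]_((5 + 5) + (5 + 5))) :=
  invmx (sqmx (rsubmx x)) *m aff_mx a (lsubmx x) *m (invmx (sqmx (rsubmx x)))^T.
pose U := [set x : 'rV[R]_((5 + 5) + (5 + 5)) | sqdom (rsubmx x)].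
have sl W : smV W (fun x : 'rV[R]_((5 + 5) + (5 + 5)) => lsubmx x).
  exact: smV_lsubmx (@smV_id _ _ _).
have sr W : smV W (fun x : 'rV[R]_((5 + 5) + (5 + 5)) => rsubmx x).
  exact: smV_rsubmx (@smV_id _ _ _).
have oU : open U by apply: (@open_sqdom _ (fun x => rsubmx x)); exact: sr.
have sA : smM U A.
  have sq : smM U (fun x => invmx (sqmx (rsubmx x))).
    apply: smM_inv; first exact: smM_sqmx.
    by move=> x Ux; rewrite -unitfE -unitmxE sqmx_unit.
  by apply: smM_mul; [apply: smM_mul => //; exact: smM_aff_mx | exact: smM_tr].
pose V := U `&` [set x | sym_coord (A x) a' != 0].
have oV : open V by apply: open_neq0 => //; exact: sA.
have chartE q' p' : sq_nbhs q' -> chart_dom (affine_chart a) p' ->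
   let x := row_mx (chart_map (affine_chart a) p') (chart_map (affine_chart b) q') in
   (chart_dom (affine_chart a') (congr_conic (invmx (sq_of q')) p') <-> sym_coord (A x)
     a' != 0) /\
   chart_map (affine_chart a') (congr_conic (invmx (sq_of q')) p') = aff_coord a' (A x).
  move=> hq' pa0 x; rewrite /A row_mxKl row_mxKr.
  have uV : invmx (sq_of q') \in unitmx by rewrite unitmx_inv sq_of_unit.
  by have [-> ->] := congr_conic_chart a' uV pa0.
exists (prod_chart (affine_chart a) (affine_chart b)),
  (prod_chart (affine_chart b) (affine_chart a')), V,
  (fun x => row_mx (rsubmx x) (aff_coord a' (A x))).
split.
- by split; [exists (affine_chart a), (affine_chart b) | exists (affine_chart b),
  (affine_chart a')];
    split=> //; eexists.
- by split.
- split; first exact: oV.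
  split; first by rewrite /U /mkset row_mxKr.
  by apply/(chartE _ _ hq pa).1.
- apply: smV_Coo => //; apply: smV_row_mx; first exact: sr.
  by apply: smV_aff_coord => [i j|x []//]; apply: smC_sub (sA i j) => x [].
- move=> [p' q'] [_ /= hq'] [/= pa0 qb'] [_ h].
  have [E1 E2] := chartE _ _ hq' pa0.
  split; first by split; [exact: qb' | apply/E1; exact: h].
  exact: (f_equal2 (fun u v => row_mx u v) (esym (row_mxKr _ _)) E2).
Qed.

End Trivialization.

(** * Connectedness of the fiber *)

Section Connectedness.
Local Open Scope quotient_scope.
Context {R : realType}.
Local Notation C := (R[i]).

Definition segment_mx (A B : 'M[C]_3) (t : R) : 'M[C]_3 := (1 - t)%:C *: A + t%:C *: B.

Lemma continuous_segment (A B : 'M[C]_3) (h : forall t, nzsym R (segment_mx A B t)) :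
  continuous (fun t => conic_of (segment_mx A B t)).
Proof.
have -> : (fun t => conic_of (segment_mx A B t)) = \pi_(conic R) \o (fun t =>
  nz_of (h t)).
  by apply/funext => t /=; rewrite -conic_of_pi.
move=> t; apply: continuous_comp; last exact: pi_continuous.
apply: continuous_comp_initial => {}t; rewrite /comp /=.
apply: continuous_mx_at => i j.
have -> : (fun s => set_val (nz_of (h s)) i j) = (fun s =>
  (1 - s)%:C * A i j + s%:C * B i j).
  by apply/funext => s; rewrite /= !mxE.
apply: (@cvgD C C^o _ (nbhs t)); apply: (@cvgM C _ (nbhs t)); try exact: cvg_cst.
  apply: (@continuous_comp _ _ _ (fun s : R => 1 - s) (fun s : R => s%:C)).
    by apply: cvgB; [exact: cvg_cst | exact: cvg_id].
  exact: continuous_real_complex.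
exact: continuous_real_complex.
Qed.

Lemma fiber1_conic_of (A : 'M[C]_3) : nzsym R A ->
  fiber1 (conic_of A) <-> dualform 1%:M A = 0.
Proof.
move=> hA; rewrite /fiber1 /=; have [k k0 ->] := conic_ofK hA.
rewrite dualformZr; split=> [/eqP|->]; last by rewrite mulr0.
by rewrite mulf_eq0 expf_eq0 /= (negPf k0) => /eqP.
Qed.

(** When A and B are isotropic and orthogonal, q_1 vanishes on their span; the real segment between
    them is already a connected set joining the two conics. *)
Lemma fiber1_line (A B : 'M[C]_3) : nzsym R A -> nzsym R B ->
  dualform 1%:M A = 0 -> dualform 1%:M B = 0 -> dualbil 1%:M A B = 0 ->
  connected_component (@fiber1 R) (conic_of A) (conic_of B).
Proof.
move=> hA hB qA qB qAB.
have [E|nE] := pselect (conic_of A = conic_of B).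
  by rewrite -E; apply: connected_component_refl; apply/fiber1_conic_of.
have h t : nzsym R (segment_mx A B t).
  have [[sA A0] [sB B0]] := (hA, hB); split.
    by rewrite /segment_mx linearD !linearZ /= sA sB.
  (* If the segment met 0, A and B would be proportional and define the same conic, the case already
     settled. *)
  apply/eqP => /eqP; rewrite addr_eq0 => /eqP AB; apply: nE.
  have [t1|t1] := eqVneq ((1 - t)%:C : C) 0.
    move: AB; rewrite t1 scale0r => /esym/eqP;
      rewrite oppr_eq0 scaler_eq0 (negPf B0) orbF.
    move=> /eqP t0; have : (1 - t)%:C + t%:C = 1 :> C by rewrite -rmorphD subrK.
    by rewrite t1 t0 addr0 => /eqP; rewrite eq_sym oner_eq0.
  apply: (@conic_of_eq _ _ _ (- (t%:C / (1 - t)%:C)) hB).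
    rewrite oppr_eq0 mulf_neq0 ?invr_eq0 //; apply: contra_neq A0 => t0.
    by move: AB; rewrite t0 scale0r oppr0 => /eqP; rewrite scaler_eq0 (negPf t1) => /eqP.
  apply: (scalerI t1); rewrite AB scalerA -scaleNr; congr (_ *: _).
  by rewrite mulrN mulrC divfK.
exists (range (fun t => conic_of (segment_mx A B t))); last first.
  by exists 1 => //; rewrite /segment_mx subrr scale0r add0r scale1r.
split.
- by exists 0 => //; rewrite /segment_mx subr0 scale0r addr0 scale1r.
- move=> _ [t _ <-]; apply/fiber1_conic_of => //.
  rewrite /segment_mx dualformD dualformZr qA qB mulr0 mulr0 addr0 add0r.
  rewrite dualbilC -[X in dualbil _ _ X]add0r dualbilDr dualbil0 dualbilC qAB.
  by rewrite mulr0 addr0 mulr0.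
- apply: connected_continuous_connected.
    by apply/connected_intervalP.
  by apply: continuous_subspaceT; exact: continuous_segment.
Qed.

Lemma quadratic_root (a b c : C) : a != 0 -> exists t, c + t * b + t ^+ 2 * a = 0.
Proof.
move=> a0; pose s := sqrtc (b ^+ 2 - 4 * c * a).
have s2 : s ^+ 2 = b ^+ 2 - 4 * c * a by exact: sqr_sqrtc.
exists ((s - b) / (2 * a)).
have -> : c = (b ^+ 2 - s ^+ 2) / (4 * a) by rewrite s2; field.
by field.
Qed.

(** Two linear conditions leave at least four of the six dimensions of symmetric matrices. A plane
    spanned by X and Y in that space is enough: either Y is isotropic, or X + t Y is for a root t of
    a quadratic equation. *)
Lemma isotropic_orthogonal (A B : 'M[C]_3) :
  exists D, [/\ nzsym R D, dualform 1%:M D = 0, dualbil 1%:M A D =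
    0 & dualbil 1%:M B D = 0].
Proof.
pose M : 'M[C]_(6, 2) := \matrix_(k, j)
  dualbil 1%:M (if j == 0 then A else B) (unit_sym k).
pose K := row_base (kermx M).
have rK : (1 < \rank (kermx M))%N.
  rewrite mxrank_ker ltn_subRL.
  exact: leq_ltn_trans (leq_add (rank_leq_col M) (leqnn 1)) _.
pose i := Ordinal (ltnW rK); pose j := Ordinal rK.
have ij : i != j by [].
pose mx (u : 'rV[C]_6) := sym_mx (u 0).
have mxD u v t : mx (u + t *: v) = mx u + t *: mx v.
  by apply/matrixP => k l; rewrite !mxE.
have mx0 u : mx u = 0 -> u = 0.
  move=> m0; apply/rowP => k; rewrite -[u 0 k](sym_mxK (u 0)) -/(mx u) m0.
  by rewrite /sym_coord !mxE.
have orth u : u *m M = 0 -> dualbil 1%:M A (mx u) = 0 /\ dualbil 1%:M B (mx u) = 0.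
  move=> /rowP uM; have := (uM 0, uM 1);
    rewrite !mxE /mx sym_mxE !dualbil_sum => -[u0 u1].
  by split; [rewrite -[RHS]u0 | rewrite -[RHS]u1]; apply: eq_bigr => k _; rewrite mxE.
have KM (w : 'rV_(\rank (kermx M))) : w *m K *m M = 0.
  by apply/sub_kermxP; rewrite -(eq_row_base (kermx M)) submxMl.
have wK (w : 'rV_(\rank (kermx M))) : w *m K = 0 -> w = 0.
  by move=> /eqP; rewrite mulmx_free_eq0 ?row_base_free // => /eqP.
pose X := mx (delta_mx 0 i *m K); pose Y := mx (delta_mx 0 j *m K).
suff [w [w0 qw]] : exists w : 'rV_(\rank (kermx M)),
  w != 0 /\ dualform 1%:M (mx (w *m K)) = 0.
  exists (mx (w *m K)); have [d1 d2] := orth _ (KM w); split=> //.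
  by split; [exact: sym_mx_tr | apply: contra_neq w0 => /mx0/wK].
have [qY|qY] := eqVneq (dualform 1%:M Y) 0.
  exists (delta_mx 0 j); split=> //; apply/eqP => /rowP/(_ j)/eqP.
  by rewrite !mxE !eqxx oner_eq0.
have [t tE] := quadratic_root (dualbil 1%:M X Y) (dualform 1%:M X) qY.
exists (delta_mx 0 i + t *: delta_mx 0 j); split.
  apply/eqP => /rowP/(_ i)/eqP.
  by rewrite !mxE !eqxx (negPf ij) mulr0 addr0 oner_eq0.
by rewrite mulmxDl -scalemxAl mxD -/X -/Y dualformD.
Qed.

Lemma connected_fiber1 : connected (@fiber1 R).
Proof.
have [->|/set0P[p0 Fp0]] := eqVneq (@fiber1 R) set0; first exact: connected0.
suff <- : connected_component (@fiber1 R) p0 = @fiber1 R by exact: component_connected.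
apply/seteqP; split=> [|p Fp]; first exact: connected_component_sub.
have [D [hD qD d0 d1]] := isotropic_orthogonal (conic_mx p0) (conic_mx p).
have := fiber1_line (conic_mx_nzsym p0) hD Fp0 qD d0.
have := fiber1_line (conic_mx_nzsym p) hD Fp qD d1.
rewrite !conic_mxK => cp c0.
by apply: connected_component_trans c0 _; exact: connected_component_sym.
Qed.

Lemma fiber1_nonempty : @fiber1 R !=set0.
Proof.
(* This is v^T v for the isotropic vector v = (1, i, 0), so tr A = 0 and A^2 = 0. *)
pose A : 'M[C]_3 := sym_mx (nth 0 [:: 1; 'i%C; 0; -1; 0; 0]).
have hA : nzsym R A.
  split; first exact: sym_mx_tr.
  apply/eqP => /matrixP/(_ i0 i0)/eqP; rewrite !mxE /sym_idx /= inordK //=.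
  by rewrite oner_eq0.
exists (conic_of A); apply/fiber1_conic_of => //.
rewrite dualform1E !mxE /sym_idx /= !inordK //=.
have := @sqr_i R; rewrite expr2 => ii.
by rewrite ii; ring.
Qed.

End Connectedness.

(** * Assembly of the bundle *)

Lemma smooth_map_on_subset (R : realType) (M N : charted R) (A B : set M) (f : M -> N) :
  A `<=` B -> smooth_map_on B f -> smooth_map_on A f.
Proof.
move=> AB sf x /AB /sf [c [d [V [g [H1 H2 H3 H4 H5]]]]].
by exists c, d, V, g; split=> // y /AB; exact: H5.
Qed.

Lemma cholesky_dom1 (R : realType) : cholesky_dom (1%:M : 'M[R[i]]_3).
Proof.
have [e0 e1] : (1%:M : 'M[R[i]]_3) i0 i1 = 0 /\ forall k, (1%:M : 'M[R[i]]_3) k k = 1.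
  by split=> [|k]; rewrite mxE ?eqxx.
by split; rewrite ?det1 /minor2 ?e0 ?e1 ?expr0n ?mulr1 ?subr0; exact: ltr01.
Qed.

(** P is taken to reduce the normalized matrix of q to the identity, which lies in [cholesky_dom].
    Hence the neighbourhoods [sq_nbhs] cover the base. *)
Lemma sq_nbhs_exists (R : realType) (q : CP5 R) : nondeg_conics R q ->
  exists (b : 'I_6) (P : 'M[R[i]]_3), P \in unitmx /\ sq_nbhs b P q.
Proof.
move=> q0; have [b qb] := chart_exists q.
have uq : aff_mx b (chart_map (affine_chart b) q) \in unitmx.
  by rewrite unitmxE unitfE -(det_chart qb).
have [P uP PE] := symmetric_congr1 (aff_mx_tr _ _) uq.
exists b, P; split=> //; split=> //.
by rewrite /sqdom /mkset PE; exact: cholesky_dom1.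
Qed.

Lemma tildeC_sq (R : realType) (b : 'I_6) (P : 'M[R[i]]_3) (q p : CP5 R) :
  P \in unitmx -> sq_nbhs b P q -> nondeg_conics R q ->
  tildeC R (congr_conic (sq_of b P q) p, q) <-> fiber1 p.
Proof.
move=> uP hq q0; rewrite tildeCE -(fiber1_sq uP p hq).
by split=> [[]|].
Qed.

Lemma trivialization (R : realType) (b : 'I_6) (P : 'M[R[i]]_3) : P \in unitmx ->
  smooth_trivialization (X := prod_charted (CP5 R) (CP5 R))
    (tildeC R) (@fiber1 R) snd (sq_nbhs b P `&` nondeg_conics R).
Proof.
move=> uP; exists (triv b P), (triv_inv b P); split; last by case.
split.
- by apply: smooth_map_on_subset (smooth_triv uP) => -[p q] [_ [hq _]].
- by apply: smooth_map_on_subset (smooth_triv_inv uP) => -[q p] [[hq _] _].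
- move=> [p q] [Epq [hq q0]]; split; last exact: (trivK uP).
  split=> //; apply/(tildeC_sq _ uP hq q0).
  by have /(congr1 fst) /= := trivK uP p hq; rewrite /triv_inv /triv /= => ->.
- move=> [q p] [[hq q0] Fp]; split; last exact: (triv_invK uP).
  by split=> //; apply/tildeC_sq.
Qed.

Theorem theorem2 (R : realType) :
  exists F : set (CP5 R),
    @smooth_fiber_bundle R (prod_charted (CP5 R) (CP5 R)) (CP5 R) (CP5 R)
      (tildeC R) (nondeg_conics R) F snd
    /\ connected F.
Proof.
exists (@fiber1 R); split; last exact: connected_fiber1.
split; [split | | | ].
- exact: submanifold_tildeC.
- exact: submanifold_nondeg.
- exact: submanifold_fiber1.
- exact: smooth_snd.
(* Surjectivity: a point of the nonempty model fiber is carried by [sq_of] into the fiber over q. *)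
- apply/seteqP; split=> [_ [[p q] [q0 _] <-] //|q q0].
  have [b [P [uP hq]]] := sq_nbhs_exists q0.
  have [p Fp] := @fiber1_nonempty R.
  by exists (congr_conic (sq_of b P q) p, q) => //; apply/tildeC_sq.
- move=> q q0; have [b [P [uP hq]]] := sq_nbhs_exists q0.
  exists (sq_nbhs b P); split=> //; first exact: open_sq_nbhs.
  exact: trivialization.
Qed.
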